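(* Let $S^2=\{(x,y,z)\in\mathbb R^3: x^2+y^2+z^2=1\}$ be equipped with the standard symplectic form, and let $F,G:S^2\to\mathbb R$ be the functions $F(x,y,z)=x^2$, $G(x,y,z)=y^2$. Then one has $$\rho_{F,G}(s)\le\rho_{F,G}(0)-C\sqrt s$$ for some $C>0$.
   Context: Let $(M,\omega)$ be a closed symplectic manifold (here $M=S^2$). For a smooth function $F$ on $M$ put $\|F\|=\max_M|F|$. The Hamiltonian vector field of $F$ is given by $i_{\mathrm{sgrad}F}\,\omega=-dF$, and the Poisson bracket is $\{F,G\}=\omega(\mathrm{sgrad}\,G,\mathrm{sgrad}\,F)$. On $\mathcal F=C^\infty(M)\times C^\infty(M)$ use the uniform distance $d((F,G),(H,K))=\|F-H\|+\|G-K\|$. For $s\ge 0$ let $\mathcal K_s=\{(H,K)\in\mathcal F:\|\{H,K\}\|\le s\}$. The profile function $\rho_{F,G}:[0,+\infty)\to\mathbb R$ of a pair $(F,G)\in\mathcal F$ is $\rho_{F,G}(s)=d((F,G),\mathcal K_s)=\inf_{(H,K)\in\mathcal K_s}d((F,G),(H,K))$; it is non-negative and non-increasing.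
   Formalization: The inequality cannot hold for all s ≥ 0 with one C > 0, since ρ is non-negative while ρ(0) − C√s tends to −∞; it is stated for 0 ≤ s ≤ s_max with s_max > 0 arbitrary and C allowed to depend on s_max. *)

(* Defs.v *)
From HB Require Import structures.
From mathcomp Require Import all_boot all_order all_algebra.
From mathcomp Require Import all_classical all_reals all_analysis.
From mathcomp Require Import ring.
Import Order.TTheory GRing.Theory Num.Theory.
Import numFieldNormedType.Exports.

Set Implicit Arguments.
Unset Strict Implicit.
Unset Printing Implicit Defensive.

Local Open Scope classical_set_scope.
Local Open Scope ring_scope.

Section SymplecticSphere.
Context {R : realType}.
Local Notation E := 'rV[R]_3.

Definition dot3 (u v : E) : R := \sum_(i < 3) u 0 i * v 0 i.

Record S2 : Type := MkS2 { S2val :> E; S2valP : dot3 S2val S2val = 1 }.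

(** C^k on U, by induction on k: f is C^(k+1) when it is differentiable on U
    and all its directional derivatives are C^k.  The notion is intended for
    an open U, on which it only depends on the values of f in U. *)
Fixpoint Ck_on (k : nat) (U : set E) (f : E -> R) : Prop :=
  match k with
  | 0 => forall x, U x -> {for x, continuous f}
  | k'.+1 => (forall x, U x -> differentiable f x)
             /\ (forall v : E, Ck_on k' U ('D_v f))
  end.

Definition Cinf_on (U : set E) (f : E -> R) : Prop := forall k, Ck_on k U f.

Definition smooth_extension (H : S2 -> R) (p : S2) (h : E -> R) : Prop :=
  exists U : set E, [/\ open U, U p, Cinf_on U h &
    forall q : S2, U q -> h q = H q].

Definition smooth (H : S2 -> R) : Prop :=
  forall p, exists h, smooth_extension H p h.

Definition tangent (p : S2) (v : E) : Prop := dot3 p v = 0.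

(** dH_p(v), computed from a smooth extension of H near p; for v tangent at p
    the choice of the extension is irrelevant, see [dS2E]. *)
Definition dS2 (H : S2 -> R) (p : S2) (v : E) : R :=
  'D_v (xget (fun=> 0) [set h | smooth_extension H p h]) (p : E).

(** The Euclidean area form omega_p(u, v) = det(p, u, v), of total area 4 pi. *)
Definition omega (p : S2) (u v : E) : R :=
  \det (col_mx (p : E) (col_mx u v) : 'M[R]_3).

Definition is_sgrad (H : S2 -> R) (p : S2) (X : E) : Prop :=
  tangent p X /\ (forall v, tangent p v -> omega p X v = - dS2 H p v).

(** Such an X exists and is unique, see [sgradP] and [is_sgrad_unique]. *)
Definition sgrad (H : S2 -> R) (p : S2) : E := xget 0 [set X | is_sgrad H p X].

Definition poisson (H K : S2 -> R) (p : S2) : R :=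
  omega p (sgrad K p) (sgrad H p).

(** On continuous functions this supremum is finite and is a maximum. *)
Definition unorm (H : S2 -> R) : R := sup [set `|H p| | p in [set: S2]].

Definition udist (A B : (S2 -> R) * (S2 -> R)) : R :=
  unorm (A.1 \- B.1) + unorm (A.2 \- B.2).

Definition Kset (s : R) : set ((S2 -> R) * (S2 -> R)) :=
  [set A | [/\ smooth A.1, smooth A.2 & unorm (poisson A.1 A.2) <= s]].

Definition profile (F G : S2 -> R) (s : R) : R :=
  inf [set udist (F, G) A | A in Kset s].

Lemma dot3E (u v : E) :
  dot3 u v = u 0 0 * v 0 0 + u 0 1 * v 0 1 + u 0 2%:R * v 0 2%:R.
Proof.
rewrite /dot3 !big_ord_recr big_ord0 /= add0r.
by congr (_ * _ + _ * _ + _ * _); congr (_ 0 _); apply: val_inj.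
Qed.

Lemma omegaE (p : S2) (u v : E) : omega p u v =
    (p : E) 0 0 * (u 0 1 * v 0 2%:R - u 0 2%:R * v 0 1)
  + (p : E) 0 1 * (u 0 2%:R * v 0 0 - u 0 0 * v 0 2%:R)
  + (p : E) 0 2%:R * (u 0 0 * v 0 1 - u 0 1 * v 0 0).
Proof.
pose M : 'M[R]_3 := col_mx (p : E) (col_mx u v).
have M0 j : M 0 j = (p : E) 0 j.
  rewrite /M (_ : (0 : 'I_3) = lshift 2 (0 : 'I_1)); last exact: val_inj.
  by rewrite (@col_mxEu R 1 2 3).
have M1 j : M 1 j = u 0 j.
  rewrite /M (_ : (1 : 'I_3) = rshift 1 (lshift 1 (0 : 'I_1))); last exact: val_inj.
  by rewrite (@col_mxEd R 1 2 3) (@col_mxEu R 1 1 3).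
have M2 j : M 2%:R j = v 0 j.
  rewrite /M (_ : (2%:R : 'I_3) = rshift 1 (rshift 1 (0 : 'I_1))); last exact: val_inj.
  by rewrite (@col_mxEd R 1 2 3) (@col_mxEd R 1 1 3).
have det22 (A : 'M[R]_2) : \det A = A 0 0 * A 1 1 - A 0 1 * A 1 0.
  rewrite (expand_det_row _ 0) !big_ord_recr big_ord0 /= add0r /cofactor !det_mx11.
  rewrite !mxE /= addn0 expr0 mul1r expr1 mulN1r mulrN.
  by congr (_ * _ - _ * _); congr (A _ _); apply: val_inj.
rewrite /omega -/M; clearbody M.
rewrite (expand_det_row _ 0) !big_ord_recr big_ord0 /= add0r.
rewrite /cofactor !det22 !mxE /=.
have o0 : widen_ord (leqnSn 2) (widen_ord (leqnSn 1) ord_max) = 0 :> 'I_3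
  by exact: val_inj.
have o1 : widen_ord (leqnSn 2) ord_max = 1 :> 'I_3 by exact: val_inj.
have o2 : ord_max = 2%:R :> 'I_3 by exact: val_inj.
rewrite o0 o1 o2.
have l00 : lift (0 : 'I_3) (0 : 'I_2) = 1 by exact: val_inj.
have l01 : lift (0 : 'I_3) (1 : 'I_2) = 2%:R by exact: val_inj.
have l10 : lift (1 : 'I_3) (0 : 'I_2) = 0 by exact: val_inj.
have l11 : lift (1 : 'I_3) (1 : 'I_2) = 2%:R by exact: val_inj.
have l20 : lift (2%:R : 'I_3) (0 : 'I_2) = 0 by exact: val_inj.
have l21 : lift (2%:R : 'I_3) (1 : 'I_2) = 1 by exact: val_inj.
rewrite ?(l00, l01, l10, l11, l20, l21) ?(M0, M1, M2) /=.
rewrite ?addn0 ?expr0 ?expr1 ?expr2.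
ring.
Qed.

Lemma is_sgrad_unique H p X X' : is_sgrad H p X -> is_sgrad H p X' -> X = X'.
Proof.
move=> [tX dX] [tX' dX'].
pose w : E := \row_j [:: (p : E) 0 1 * (X - X') 0 2%:R - (p : E) 0 2%:R * (X - X') 0 1;
   (p : E) 0 2%:R * (X - X') 0 0 - (p : E) 0 0 * (X - X') 0 2%:R;
   (p : E) 0 0 * (X - X') 0 1 - (p : E) 0 1 * (X - X') 0 0]`_j.
have tw : tangent p w by rewrite /tangent dot3E !mxE /=; ring.
have := dX _ tw; rewrite -(dX' _ tw) !omegaE.
have := S2valP p; move: tX tX'; rewrite /tangent !dot3E !mxE /=.
set p0 := (p : E) 0 0; set p1 := (p : E) 0 1; set p2 := (p : E) 0 2%:R.
set x0 := X 0 0; set x1 := X 0 1; set x2 := X 0 2%:R.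
set y0 := X' 0 0; set y1 := X' 0 1; set y2 := X' 0 2%:R.
move=> tX tX' np e.
have sq : (x0 - y0) ^+ 2 + (x1 - y1) ^+ 2 + (x2 - y2) ^+ 2 = 0.
  transitivity ((p0 * p0 + p1 * p1 + p2 * p2) *
    ((x0 - y0) ^+ 2 + (x1 - y1) ^+ 2 + (x2 - y2) ^+ 2)
    - ((p0 * x0 + p1 * x1 + p2 * x2) - (p0 * y0 + p1 * y1 + p2 * y2)) ^+ 2).
    by rewrite np tX tX'; ring.
  by move/eqP: e; rewrite -subr_eq0 => /eqP <-; ring.
move: sq => /eqP; rewrite !paddr_eq0 ?addr_ge0 ?sqr_ge0 // !sqrf_eq0 !subr_eq0.
move=> /andP[/andP[/eqP e0 /eqP e1] /eqP e2].
apply/rowP => j; suff : [\/ j = 0, j = 1 | j = 2%:R].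
  by case=> ->.
case: j => [[|[|[|//]]] i].
- by constructor 1; apply: val_inj.
- by constructor 2; apply: val_inj.
- by constructor 3; apply: val_inj.
Qed.

Lemma dS2E H p h v : smooth_extension H p h -> tangent p v ->
  dS2 H p v = 'D_v h (p : E).
Proof.
move=> hh tv; rewrite /dS2.
case: xgetP => [k _ /=|/(_ h)]; last by [].
move: hh => [U [oU Up Uh hU]] [V [oV Vp Vk kV]].
have dh : differentiable h (p : E) by have [+ _] := Uh 1%N; apply.
have dk : differentiable k (p : E) by have [+ _] := Vk 1%N; apply.
pose c := dot3 v v.
have c0 : 0 <= c by rewrite /c dot3E; rewrite !addr_ge0 // -expr2 sqr_ge0.
have q0 t : 1 + c * t ^+ 2 != 0.
  by rewrite gt_eqF // ltr_wpDr // mulr_ge0 // sqr_ge0.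
(* a curve in the sphere through p with velocity 2 v *)
pose a (t : R) : R := (1 - c * t ^+ 2) / (1 + c * t ^+ 2).
pose b (t : R) : R := 2 * t / (1 + c * t ^+ 2).
pose g (t : R) : E := a t *: (p : E) + b t *: v.
have gS t : dot3 (g t) (g t) = 1.
  have np := S2valP p; move: np tv (q0 t).
  rewrite /g /a /b /tangent /c !dot3E !mxE.
  set p0 := (p : E) 0 0; set p1 := (p : E) 0 1; set p2 := (p : E) 0 2%:R.
  move=> np tv; set C := (_ + _ * v 0 2%:R); set q := 1 + _ => qn.
  transitivity ((1 - C * t ^+ 2) ^+ 2 / q ^+ 2 * (p0 * p0 + p1 * p1 + p2 * p2)
    + 2 * ((1 - C * t ^+ 2) / q * (2 * t / q))
        * (p0 * v 0 0 + p1 * v 0 1 + p2 * v 0 2%:R)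
    + (2 * t / q) ^+ 2 * C).
    by rewrite /C; field.
  by rewrite np tv /q; field.
have g0 : g 0 = (p : E).
  by rewrite /g /a /b expr0n /= !mulr0 subr0 addr0 divr1 mul0r scale1r scale0r addr0.
have dsq : is_derive (0 : R) (1 : R) (fun t => c * t ^+ 2) 0.
  rewrite (_ : (fun t => _) = c \*: (id ^+ 2)); last by apply/funext.
  by apply: is_derive_eq; rewrite /= expr1 mulr0 scale0r scaler0.
have dqi : is_derive (0 : R) (1 : R) (fun t => (1 + c * t ^+ 2)^-1) 0.
  have dq : is_derive (0 : R) (1 : R) (fun t => 1 + c * t ^+ 2) 0.
    rewrite (_ : (fun t => _) = cst 1 + (fun t => c * t ^+ 2)); last by apply/funext.
    by apply: is_derive_eq; rewrite addr0.
  apply: DeriveDef; first by apply: derivableV; [exact: q0|exact: ex_derive].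
  rewrite deriveV; [|exact: q0|exact: ex_derive].
  by rewrite (@derive_val _ _ _ _ _ _ _ dq) scaler0.
have da : is_derive (0 : R) (1 : R) a 0.
  rewrite (_ : a = (cst 1 - (fun t => c * t ^+ 2)) * (fun t => (1 + c * t ^+ 2)^-1));
    last by apply/funext.
  by apply: is_derive_eq; rewrite subr0 !scaler0 addr0.
have db : is_derive (0 : R) (1 : R) b 2.
  rewrite (_ : b = (2 \*: id) * (fun t => (1 + c * t ^+ 2)^-1)); last by apply/funext.
  apply: is_derive_eq; rewrite scaler0 add0r expr0n /= mulr0 addr0 invr1 scale1r.
  exact: mulr1.
clearbody a b.
have ad : differentiable a 0 by apply/derivable1_diffP; exact: ex_derive.
have bd : differentiable b 0 by apply/derivable1_diffP; exact: ex_derive.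
have a1 : 'd a 0 1 = 0 by rewrite -deriveE //; exact: (@derive_val _ _ _ _ _ _ _ da).
have b1 : 'd b 0 1 = 2 by rewrite -deriveE //; exact: (@derive_val _ _ _ _ _ _ _ db).
pose g1 (t : R) : E := a t *: (p : E); pose g2 (t : R) : E := b t *: v.
have g1d : differentiable g1 0 by exact: differentiableZl.
have g2d : differentiable g2 0 by exact: differentiableZl.
have gE : g = g1 + g2 by apply/funext.
have dgd : differentiable g 0 by rewrite gE; exact: differentiableD.
have e1 : 'd g1 0 1 = 'd a 0 1 *: (p : E).
  exact: (congr1 (fun f : R -> E => f 1) (diffZl (p : E) ad)).
have e2 : 'd g2 0 1 = 'd b 0 1 *: v.
  exact: (congr1 (fun f : R -> E => f 1) (diffZl v bd)).
clearbody g g1 g2.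
have dg : 'd g 0 1 = 2 *: v.
  rewrite gE; apply: (etrans (congr1 (fun f : R -> E => f 1) (diffD g1d g2d))).
  by apply: (etrans (congr2 +%R e1 e2)); rewrite a1 b1 scale0r add0r.
have key (f : E -> R) : differentiable f (p : E) ->
    'D_1 (f \o g) 0 = 2 * 'D_v f (p : E).
  move=> df.
  have dfg : differentiable f (g 0) by rewrite g0.
  rewrite deriveE; last exact: differentiable_comp.
  rewrite diff_comp // /= dg g0.
  by rewrite linearZ /= -deriveE.
suff : 2 * 'D_v k (p : E) = 2 * 'D_v h (p : E) by apply: mulfI; rewrite pnatr_eq0.
rewrite -!key //; apply: near_eq_derive.
have UV : nbhs (g 0) (U `&` V).
  by rewrite g0; apply: open_nbhs_nbhs; split; [exact: openI|split].
have nUV : \forall t \near 0, (U `&` V) (g t).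
  exact: (differentiable_continuous dgd UV).
near=> t; have [Ut Vt] : (U `&` V) (g t) by near: t.
rewrite /=.
by rewrite (hU (MkS2 (gS t))) // (kV (MkS2 (gS t))).
Unshelve. all: by end_near.
Qed.

Lemma sgradP H p : smooth H -> is_sgrad H p (sgrad H p).
Proof.
move=> sH; rewrite /sgrad.
have [h hh] := sH p.
have dh : differentiable h (p : E) by have [U [_ Up /(_ 1%N)[+ _] _]] := hh; apply.
pose l j : R := 'D_(delta_mx 0 j) h (p : E).
have dE v : tangent p v -> dS2 H p v =
    v 0 0 * l 0 + v 0 1 * l 1 + v 0 2%:R * l 2%:R.
  move=> tv; rewrite (dS2E hh tv) deriveE // {1}(row_sum_delta v) linear_sum.
  rewrite !big_ord_recr big_ord0 /= add0r !linearZ /= /l !deriveE //.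
  by congr (_ + _ + _); congr (_ 0 _ *: 'd h _ (delta_mx 0 _)); apply: val_inj.
clearbody l.
pose X : E := \row_j [:: (p : E) 0 1 * l 2%:R - (p : E) 0 2%:R * l 1;
   (p : E) 0 2%:R * l 0 - (p : E) 0 0 * l 2%:R;
   (p : E) 0 0 * l 1 - (p : E) 0 1 * l 0]`_j.
suff XP : is_sgrad H p X by case: xgetP => [//|/(_ X)].
split; first by rewrite /tangent dot3E !mxE /=; ring.
move=> v tv; rewrite dE // omegaE !mxE /=.
have := S2valP p; move: tv; rewrite /tangent !dot3E.
set p0 := (p : E) 0 0; set p1 := (p : E) 0 1; set p2 := (p : E) 0 2%:R.
move=> tv np.
transitivity ((p0 * l 0 + p1 * l 1 + p2 * l 2%:R)
  * (p0 * v 0 0 + p1 * v 0 1 + p2 * v 0 2%:R)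
  - (p0 * p0 + p1 * p1 + p2 * p2)
   * (v 0 0 * l 0 + v 0 1 * l 1 + v 0 2%:R * l 2%:R)).
  ring.
by rewrite tv np; ring.
Qed.

End SymplecticSphere.

Arguments S2 R : clear implicits.

(* Main.v *)
(** Lower bound [1 / 2] at [s = 0].  Suppose [{H, K} = 0], [|F - H| <= a] and
    [|G - K| <= b].  On the octant of the sphere, [H <= a] on the side [x = 0],
    [K <= b] on the side [y = 0], and [H + K >= 1 - a - b] on the side [z = 0].
    If [a + b < 1 / 2], applying cutoffs to [H] and [K] gives a C^1 map from
    the octant to the plane which sends the three sides to the three sides of
    a triangle, so by Stokes its signed area is that of the triangle; but it
    has rank at most one everywhere, hence zero area.  Stokes is used on a
    grid, where it is a telescoping sum.

    Upper bound [1 / 2 - tau / 4] at [s = 600 tau ^ 2].  The optimal pair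
    [max (F - 1/4, 1/4), max (G - 1/4, 1/4)] commutes and is constant on the
    part of the sphere where [F <= 1/2] and [G <= 1/2].  There it is moved by
    a map with values in a square of size [tau], of Jacobian [O(tau ^ 2)].
    The map is steep only near the points [F = G = 1/2], where it is almost
    of rank one.
    Taking [tau] proportional to [sqrt s] gives the gain [C sqrt s]. *)

Require Import Defs.
From mathcomp Require Import all_boot all_order all_algebra.
From mathcomp Require Import all_classical all_reals all_analysis.
From mathcomp Require Import ring lra.
Import Order.TTheory GRing.Theory Num.Theory.
Import numFieldNormedType.Exports.
Local Open Scope ring_scope.

Set Implicit Arguments.
Unset Strict Implicit.
Unset Printing Implicit Defensive.

(** * Closure properties of smooth functions *)

Section SmoothCalculus.
Local Open Scope classical_set_scope.
Context {R : realType}.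
Local Notation E := 'rV[R]_3.
Implicit Types (f g : E -> R) (k : nat).

Lemma Ck_onW k (U : set E) f : Ck_on k.+1 U f -> Ck_on k U f.
Proof.
elim: k f => [|k IH] f [df Df].
  by move=> x /df; exact: differentiable_continuous.
by split=> // v; exact: IH.
Qed.

Lemma Ck_cst k (U : set E) (c : R) : Ck_on k U (cst c).
Proof.
elim: k c => [|k IH] c; first by move=> x _; exact: cst_continuous.
split=> [x _|v]; first exact: differentiable_cst.
rewrite (_ : 'D_v _ = cst 0); first exact: IH.
by apply/funext => x; rewrite derive_cst.
Qed.

Lemma derive_coord (i : 'I_3) (x v : E) : 'D_v (fun y : E => y 0 i) x = v 0 i.
Proof.
have @f : {linear E -> R}.
  by exists (fun y : E => y 0 i); do 2![eexists]; do ?[constructor];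
     rewrite ?mxE// => ? *; rewrite ?mxE//; move=> ?; rewrite !mxE.
rewrite (_ : (fun _ => _) = f) // deriveE; last exact: differentiable_coord.
by rewrite diff_lin //; exact: coord_continuous.
Qed.

Lemma CkD k f g : Ck_on k setT f -> Ck_on k setT g -> Ck_on k setT (f \+ g).
Proof.
elim: k f g => [|k IH] f g.
  by move=> cf cg x xT; apply: continuousD; [exact: (cf x xT)|exact: (cg x xT)].
move=> [df Df] [dg Dg]; split=> [x xT|v].
  by apply: differentiableD; [exact: (df x I)|exact: (dg x I)].
rewrite (_ : 'D_v _ = 'D_v f \+ 'D_v g); first by apply: IH; [exact: Df|exact: Dg].
apply/funext => x; apply: deriveD; apply: diff_derivable; [exact: (df x I)|exact: (dg x I)].
Qed.

Lemma CkM k f g : Ck_on k setT f -> Ck_on k setT g -> Ck_on k setT (f \* g).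
Proof.
elim: k f g => [|k IH] f g.
  by move=> cf cg x xT; apply: continuousM; [exact: (cf x xT)|exact: (cg x xT)].
move=> cf cg; have [df Df] := cf; have [dg Dg] := cg; split=> [x xT|v].
  by apply: differentiableM; [exact: (df x I)|exact: (dg x I)].
rewrite (_ : 'D_v _ = (f \* 'D_v g) \+ (g \* 'D_v f)).
  by apply: CkD; apply: IH; by [exact: Ck_onW|exact: Df|exact: Dg].
apply/funext => x; apply: deriveM; apply: diff_derivable; [exact: (df x I)|exact: (dg x I)].
Qed.

Lemma CkV k f : (forall x, f x != 0) -> Ck_on k setT f ->
  Ck_on k setT (fun x => (f x)^-1).
Proof.
move=> f0; elim: k => [|k IH].
  by move=> cf x xT; apply: continuousV => //; exact: (cf x xT).
move=> cf; have [df Df] := cf; split=> [x xT|v].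
  by apply: differentiableV => //; exact: (df x I).
have fV := IH (Ck_onW cf).
rewrite (_ : 'D_v _ = (cst (-1) \* ((fun x => (f x)^-1) \* (fun x => (f x)^-1)))
   \* 'D_v f).
  by apply: CkM (Df v); apply: CkM; [exact: Ck_cst|exact: CkM].
apply/funext => x; rewrite deriveV //; last by apply: diff_derivable; exact: (df x I).
by rewrite /= mulN1r /GRing.scale /= -expr2 exprVn.
Qed.

Lemma derive_comp1 f (h : R -> R) (x v : E) (l : R) : differentiable f x ->
  is_derive (f x) 1 h l ->
  differentiable (h \o f) x /\ 'D_v (h \o f) x = l * 'D_v f x.
Proof.
move=> df hl.
have dh : differentiable h (f x) by apply/derivable1_diffP; exact: ex_derive.
have dhf : differentiable (h \o f) x by exact: differentiable_comp.
split=> //; rewrite !deriveE // diff_comp //=.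
have e : 'd h (f x) 1 = l.
  by rewrite -deriveE //; exact: (@derive_val _ _ _ _ _ _ _ hl).
rewrite -[X in 'd h (f x) X]mulr1.
by rewrite [LHS](linearZ_LR ('d h (f x))) e mulrC.
Qed.

Lemma Ck_sqrt k f : (forall x, 0 < f x) -> Ck_on k setT f ->
  Ck_on k setT (fun x => Num.sqrt (f x)).
Proof.
move=> f0; elim: k => [|k IH].
  move=> cf x xT; apply: (@continuous_comp _ _ _ f Num.sqrt); first exact: (cf x xT).
  exact: sqrt_continuous.
move=> cf; have [df Df] := cf.
have key x v := derive_comp1 v (df x I) (is_derive1_sqrt (f0 x)).
split=> [x xT|v]; first by have [] := key x 0.
have fV := IH (Ck_onW cf).
rewrite (_ : 'D_v _ = (fun x => (2 * Num.sqrt (f x))^-1) \* 'D_v f).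
  apply: CkM (Df v); apply: CkV => [x|]; first by rewrite gt_eqF // mulr_gt0 // sqrtr_gt0.
  by apply: (@CkM _ (cst 2)) => //; exact: Ck_cst.
by apply/funext => x; exact: (key x v).2.
Qed.

Lemma Cinf_cst (c : R) : Cinf_on setT (cst c : E -> R).
Proof. by move=> k; exact: Ck_cst. Qed.

Lemma CinfD f g : Cinf_on setT f -> Cinf_on setT g -> Cinf_on setT (f \+ g).
Proof. by move=> cf cg k; exact: CkD. Qed.

Lemma CinfM f g : Cinf_on setT f -> Cinf_on setT g -> Cinf_on setT (f \* g).
Proof. by move=> cf cg k; exact: CkM. Qed.

Lemma CinfV f : (forall x, f x != 0) -> Cinf_on setT f ->
  Cinf_on setT (fun x => (f x)^-1).
Proof. by move=> f0 cf k; exact: CkV. Qed.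

Lemma Cinf_sqrt f : (forall x, 0 < f x) -> Cinf_on setT f ->
  Cinf_on setT (fun x => Num.sqrt (f x)).
Proof. by move=> f0 cf k; exact: Ck_sqrt. Qed.

End SmoothCalculus.

(** * Poisson brackets through smooth extensions *)

Section PoissonBracket.
Local Open Scope classical_set_scope.
Context {R : realType}.
Local Notation E := 'rV[R]_3.
Implicit Types (h k : E -> R) (H K : S2 R -> R) (p q : S2 R) (x v : E).

Definition partial h (j : 'I_3) x : R := 'D_(delta_mx 0 j) h x.

Lemma derive_partialE h x v : differentiable h x ->
  'D_v h x = v 0 0 * partial h 0 x + v 0 1 * partial h 1 x
             + v 0 2%:R * partial h 2%:R x.
Proof.
move=> dh; rewrite deriveE // {1}(row_sum_delta v) linear_sum.
rewrite !big_ord_recr big_ord0 /= add0r !linearZ /= /partial !deriveE //.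
by congr (_ + _ + _); congr (_ 0 _ *: 'd h _ (delta_mx 0 _)); apply: val_inj.
Qed.

Definition ambient_bracket h k x : R :=
    x 0 0 * (partial h 1 x * partial k 2%:R x - partial h 2%:R x * partial k 1 x)
  + x 0 1 * (partial h 2%:R x * partial k 0 x - partial h 0 x * partial k 2%:R x)
  + x 0 2%:R * (partial h 0 x * partial k 1 x - partial h 1 x * partial k 0 x).

Lemma smooth_extension_differentiable H p h :
  smooth_extension H p h -> differentiable h (p : E).
Proof. by move=> [U [_ Up /(_ 1%N) [+ _] _]]; apply. Qed.

Lemma sgradE H p h : smooth_extension H p h ->
  sgrad H p = \row_j [::
    (p : E) 0 1 * partial h 2%:R p - (p : E) 0 2%:R * partial h 1 p;
    (p : E) 0 2%:R * partial h 0 p - (p : E) 0 0 * partial h 2%:R p;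
    (p : E) 0 0 * partial h 1 p - (p : E) 0 1 * partial h 0 p]`_j.
Proof.
move=> hh; set X := \row_j _.
have XP : is_sgrad H p X.
  split; first by rewrite /tangent dot3E !mxE /=; ring.
  move=> v tv; rewrite (dS2E hh tv) derive_partialE; last first.
    exact: smooth_extension_differentiable hh.
  rewrite omegaE !mxE /=; have := S2valP p; move: tv; rewrite /tangent !dot3E.
  set p0 := (p : E) 0 0; set p1 := (p : E) 0 1; set p2 := (p : E) 0 2%:R.
  set l0 := partial h 0 p; set l1 := partial h 1 p; set l2 := partial h 2%:R p.
  move=> tv np.
  transitivity ((p0 * l0 + p1 * l1 + p2 * l2)
    * (p0 * v 0 0 + p1 * v 0 1 + p2 * v 0 2%:R)
    - (p0 * p0 + p1 * p1 + p2 * p2) * (v 0 0 * l0 + v 0 1 * l1 + v 0 2%:R * l2)).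
    by ring.
  by rewrite tv np; ring.
apply: (is_sgrad_unique (H := H) (p := p)) (XP); rewrite /sgrad.
by case: xgetP => [Y _ //|/(_ X)].
Qed.

Lemma poissonE H K p h k : smooth_extension H p h -> smooth_extension K p k ->
  poisson H K p = - ambient_bracket h k p.
Proof.
move=> hh kk; rewrite /poisson (sgradE hh) (sgradE kk) omegaE !mxE /=.
have := S2valP p; rewrite dot3E /ambient_bracket.
set p0 := (p : E) 0 0; set p1 := (p : E) 0 1; set p2 := (p : E) 0 2%:R.
set l0 := partial h 0 p; set l1 := partial h 1 p; set l2 := partial h 2%:R p.
set m0 := partial k 0 p; set m1 := partial k 1 p; set m2 := partial k 2%:R p.
move=> np.
transitivity (- (p0 * p0 + p1 * p1 + p2 * p2) * (p0 * (l1 * m2 - l2 * m1)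
  + p1 * (l2 * m0 - l0 * m2) + p2 * (l0 * m1 - l1 * m0))); first by ring.
by rewrite np; ring.
Qed.

Lemma partial_continuous H p h j : smooth_extension H p h ->
  {for (p : E), continuous (partial h j)}.
Proof.
move=> [U [oU Up Uh _]].
have [_ Dh] := Uh 1%N; exact: (Dh (delta_mx 0 j) (p : E) Up).
Qed.

Lemma S2_compact : compact [set x : E | dot3 x x = 1].
Proof.
have Mnco : compact [set v : E | forall i, v ord0 i \in `[(-1 : R), 1]%R].
  apply: (@rV_compact _ _ (fun=> `[(-1 : R), 1]%classic)) => _.
  exact: segment_compact.
apply: subclosed_compact Mnco _.
  rewrite (_ : [set x | _] = (fun x : E => dot3 x x) @^-1` [set 1]) //.
  apply: closed_comp; last exact: closed_eq.
  pose c (j : 'I_3) (x : E) := x 0 j.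
  move=> x _; rewrite (_ : (fun x => _) = c 0 \* c 0 \+ c 1 \* c 1
    \+ c 2%:R \* c 2%:R); last by apply/funext => y; rewrite dot3E.
  by apply: continuousD; [apply: continuousD|]; apply: continuousM;
    exact: coord_continuous.
move=> v /= v1 i; rewrite in_itv /= -ler_norml -(@ler_sqr _ `|_|) ?nnegrE //.
rewrite expr1n real_normK ?num_real // -v1 /dot3 (bigD1 i) //= -expr2 lerDl.
by apply: sumr_ge0 => j _; rewrite -expr2 sqr_ge0.
Qed.

Lemma S2_bounded (f : S2 R -> R) :
  (forall p, exists U (g : E -> R), [/\ nbhs (p : E) U,
     {for (p : E), continuous g} & forall q, U q -> f q = g q]) ->
  exists M, forall q, `|f q| <= M.
Proof.
move=> fg; have /compact_near_coveringP cS := S2_compact.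
have := cS R +oo%R (fun M x => forall q, (q : E) = x -> `|f q| <= M) _.
case=> [x /= x1|M [_ MP]].
  have [U [g [Up gc fU]]] := fg (MkS2 x1).
  have gn : {for x, continuous (fun y => `|g y|)}.
    by apply: continuous_comp gc (@norm_continuous _ _ _).
  have gU : \forall y \near x, `|g y| < `|g x| + 1.
    by apply: (cvgr_lt _ gn); rewrite ltrDl.
  exists (U `&` [set y | `|g y| < `|g x| + 1], [set M | `|g x| + 1 <= M]).
    by split; [exact: filterI|exact: nbhs_pinfty_ge].
  move=> [y M] /= [[Uy gy] gM] q qy; rewrite fU ?qy //.
  exact: le_trans (ltW gy) gM.
exists (M + 1) => q; apply: (MP (M + 1)) => //=; first by rewrite ltrDl.
by rewrite S2valP.
Qed.

Lemma smooth_local_cont H : smooth H -> forall p, exists U h, [/\ nbhs (p : E) U,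
  {for (p : E), continuous h} & forall q, U q -> H q = h q].
Proof.
move=> sH p; have [h hh] := sH p; have [U [oU Up Uh hU]] := hh.
exists U, h; split=> [||q Uq]; [exact: open_nbhs_nbhs| |by rewrite hU].
exact/differentiable_continuous/(smooth_extension_differentiable hh).
Qed.

Lemma smooth_bounded H K : smooth H -> smooth K -> exists M, forall q, `|H q - K q| <= M.
Proof.
move=> sH sK; apply: (S2_bounded (f := fun q => H q - K q)) => p.
have [U [h [Up hc Hh]]] := smooth_local_cont sH p.
have [V [k [Vp kc Kk]]] := smooth_local_cont sK p.
exists (U `&` V), (fun x => h x - k x); split=> [||q [Uq Vq]].
- exact: filterI.
- by apply: continuousB.
- by rewrite Hh // Kk.
Qed.

Lemma poisson_bounded H K : smooth H -> smooth K ->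
  exists M, forall q, `|poisson H K q| <= M.
Proof.
move=> sH sK; apply: S2_bounded => p.
have [h hh] := sH p; have [k kk] := sK p.
have hc j := @partial_continuous H p h j hh; have kc j := @partial_continuous K p k j kk.
have [U [oU Up Uh hU]] := hh; have [V [oV Vp Vk kV]] := kk.
exists (U `&` V), (fun x => - ambient_bracket h k x); split=> [||q [Uq Vq]].
- by apply: open_nbhs_nbhs; split; [exact: openI|split].
- pose c (j : 'I_3) (x : E) := x 0 j.
  have cc j : {for (p : E), continuous (c j)} by exact: coord_continuous.
  have mc j i i' : {for (p : E), continuous
      (c j \* (partial h i \* partial k i' \- partial h i' \* partial k i))}.
    apply: continuousM; first exact: cc.
    by apply: continuousB; apply: continuousM; [exact: hc|exact: kc|exact: hc|exact: kc].
  exact: (continuousN (continuousD (continuousD (mc 0 1 2%:R) (mc 1 2%:R 0)) (mc 2%:R 0 1))).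
- by apply: poissonE; [exists U|exists V].
Qed.

Lemma unorm_ge0 H : 0 <= unorm H.
Proof.
rewrite /unorm; set A := (X in sup X).
have [[[x Ax] ubA]|/sup_out -> //] := pselect (has_sup A).
apply: (@le_trans _ _ x); last exact: ub_le_sup.
by case: Ax => p _ <-.
Qed.

Lemma norm_le_unorm H p : (exists M, forall q, `|H q| <= M) -> `|H p| <= unorm H.
Proof.
move=> [M HM]; apply: ub_le_sup; last by exists p.
by exists M => _ [q _ <-].
Qed.

Lemma unorm_le H (M : R) : 0 <= M -> (forall q, `|H q| <= M) -> unorm H <= M.
Proof.
move=> M0 HM; rewrite /unorm; set A := (X in sup X).
have [[A0 _]|/sup_out -> //] := pselect (has_sup A).
by apply: ge_sup => // _ [q _ <-].
Qed.

Lemma poisson_eq0 H K : smooth H -> smooth K -> unorm (poisson H K) <= 0 ->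
  forall p, poisson H K p = 0.
Proof.
move=> sH sK n0 p; apply/eqP; rewrite -normr_le0; apply: le_trans n0.
by apply: norm_le_unorm; exact: poisson_bounded.
Qed.

End PoissonBracket.

(** * Strict differentiability and maps of rank one *)

Section DiscreteStokes.
Context {R : realType}.

Definition edge (p q : R * R) : R := p.1 * q.2 - q.1 * p.2.

Definition cell (p00 p10 p11 p01 : R * R) : R :=
  edge p00 p10 + edge p10 p11 + edge p11 p01 + edge p01 p00.

Lemma cellE p00 p10 p11 p01 : cell p00 p10 p11 p01 =
  (p11.1 - p00.1) * (p01.2 - p10.2) - (p01.1 - p10.1) * (p11.2 - p00.2).
Proof. by rewrite /cell /edge; ring. Qed.

Lemma sum_cells n (P : nat -> nat -> R * R) :
  \sum_(0 <= i < n) \sum_(0 <= j < n)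
    cell (P i j) (P i.+1 j) (P i.+1 j.+1) (P i j.+1) =
  \sum_(0 <= i < n) edge (P i 0%N) (P i.+1 0%N)
  - \sum_(0 <= i < n) edge (P i n) (P i.+1 n)
  + \sum_(0 <= j < n) edge (P n j) (P n j.+1)
  - \sum_(0 <= j < n) edge (P 0%N j) (P 0%N j.+1).
Proof.
have cellD i j : cell (P i j) (P i.+1 j) (P i.+1 j.+1) (P i j.+1) =
    - (edge (P i j.+1) (P i.+1 j.+1) - edge (P i j) (P i.+1 j))
    + (edge (P i.+1 j) (P i.+1 j.+1) - edge (P i j) (P i j.+1)).
  by rewrite /cell /edge; ring.
under eq_bigr do under eq_bigr do rewrite cellD.
under eq_bigr do rewrite big_split /= sumrN telescope_sumr //.
rewrite big_split /= sumrN sumrB.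
rewrite [X in _ + X = _]exchange_big /=.
under [X in _ + X = _]eq_bigr do rewrite telescope_sumr //.
by rewrite !sumrB; ring.
Qed.

Lemma sum_cells_triangle n (P : nat -> nat -> R * R) :
  (forall j, (P 0%N j).1 + (P 0%N j).2 = 1) ->
  (P 0%N 0%N).1 = 1 -> (P 0%N n).1 = 0 ->
  (forall i, (P i 0%N).2 = 0) -> (forall i, (P i n).1 = 0) ->
  (forall j, P n j = (0, 0)) ->
  \sum_(0 <= i < n) \sum_(0 <= j < n)
    cell (P i j) (P i.+1 j) (P i.+1 j.+1) (P i j.+1) = - 1.
Proof.
move=> P0 P00 P0n Pi0 Pin Pn; rewrite sum_cells.
rewrite [X in X - _ + _ - _]big1 => [|i _]; last by rewrite /edge !Pi0; ring.
rewrite [X in _ - X + _ - _]big1 => [|i _]; last by rewrite /edge !Pin; ring.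
rewrite [X in _ - _ + X - _]big1 => [|i _]; last by rewrite /edge !Pn /=; ring.
have e j : edge (P 0%N j) (P 0%N j.+1) = - ((P 0%N j.+1).1 - (P 0%N j).1).
  have P2 k : (P 0%N k).2 = 1 - (P 0%N k).1 by rewrite -(P0 k); ring.
  by rewrite /edge !P2; ring.
under eq_bigr do rewrite e.
by rewrite sumrN telescope_sumr // P0n P00; ring.
Qed.

End DiscreteStokes.

Section StrictDerivative.
Local Open Scope classical_set_scope.
Context {R : realType}.
Implicit Types (f g : R * R -> R) (z w : R * R) (l m : R * R).

Definition dist1 z w : R := `|z.1 - w.1| + `|z.2 - w.2|.

Definition lin2 l z w : R := l.1 * (z.1 - w.1) + l.2 * (z.2 - w.2).

(* Both points move, so that increments over small cells near [z] that do not
   contain [z] are controlled too. *)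
Definition strict_diff f z l : Prop := forall e : R, 0 < e ->
  exists2 d, 0 < d & forall w w', dist1 w z < d -> dist1 w' z < d ->
  `|f w - f w' - lin2 l w w'| <= e * dist1 w w'.

Definition strict_diff1 (f : R -> R) (x l : R) : Prop := forall e : R, 0 < e ->
  exists2 d, 0 < d & forall y y', `|y - x| < d -> `|y' - x| < d ->
  `|f y - f y' - l * (y - y')| <= e * `|y - y'|.

Lemma dist1_ge0 z w : 0 <= dist1 z w.
Proof. by rewrite addr_ge0. Qed.

Lemma dist1zz z : dist1 z z = 0.
Proof. by rewrite /dist1 !subrr normr0 addr0. Qed.

Lemma lin2_le l z w : `|lin2 l z w| <= (`|l.1| + `|l.2|) * dist1 z w.
Proof.
rewrite (le_trans (ler_normD _ _)) // !normrM /dist1 mulrDl.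
by rewrite lerD // ler_wpM2l // ?lerDl ?lerDr.
Qed.

Lemma strict_diff_lip f z l : strict_diff f z l ->
  exists2 d, 0 < d & forall w w', dist1 w z < d -> dist1 w' z < d ->
  `|f w - f w'| <= (`|l.1| + `|l.2| + 1) * dist1 w w'.
Proof.
move=> /(_ _ ltr01) [d d0 H]; exists d => // w w' wd wd'.
rewrite -(subrK (lin2 l w w') (f w - f w')) (le_trans (ler_normD _ _)) //.
by rewrite mulrDl addrC lerD ?lin2_le ?H.
Qed.

Lemma strict_diff_cont f z l : strict_diff f z l -> forall e : R, 0 < e ->
  exists2 d, 0 < d & forall w, dist1 w z < d -> `|f w - f z| < e.
Proof.
move=> /strict_diff_lip [d d0 H] e e0; set C := _ + 1 in H.
have C0 : 0 < C by rewrite /C ltr_wpDl // addr_ge0.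
exists (Order.min d (e / C)); first by rewrite lt_min d0 divr_gt0.
move=> w; rewrite lt_min => /andP[wd we].
rewrite (le_lt_trans (H _ _ wd _)) ?dist1zz //.
by rewrite mulrC -ltr_pdivlMr.
Qed.

Lemma strict_diff_comp1 f z l (t : R -> R) (c : R) :
  strict_diff f z l -> strict_diff1 t (f z) c ->
  strict_diff (t \o f) z (c * l.1, c * l.2).
Proof.
move=> fl tc e e0; have [d1 d10 L] := strict_diff_lip fl.
set C := _ + 1 in L.
have C0 : 0 < C by rewrite /C ltr_wpDl // addr_ge0.
have [d2 d20 T] := tc (e / 2 / C) ltac:(by rewrite !divr_gt0).
have [d3 d30 F3] := strict_diff_cont fl d20.
have c0 : 0 < `|c| + 1 by rewrite ltr_wpDl.
have [d4 d40 F4] := fl (e / 2 / (`|c| + 1)) ltac:(by rewrite !divr_gt0).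
exists (Order.min (Order.min d1 d3) d4); first by rewrite !lt_min d10 d30 d40.
move=> w w'; rewrite !lt_min => /andP[/andP[w1 w3] w4] /andP[/andP[v1 v3] v4].
have -> : (t \o f) w - (t \o f) w' - lin2 (c * l.1, c * l.2) w w' =
   (t (f w) - t (f w') - c * (f w - f w')) + c * (f w - f w' - lin2 l w w').
  by rewrite /lin2 /=; ring.
rewrite (le_trans (ler_normD _ _)) // normrM.
have /le_trans A1 := T _ _ (F3 _ w3) (F3 _ v3).
have {A1} := A1 (e / 2 * dist1 w w').
have : e / 2 / C * `|f w - f w'| <= e / 2 * dist1 w w'.
  rewrite -mulrA ler_wpM2l ?divr_ge0 ?(ltW e0) // mulrC ler_pdivrMr // mulrC.
  exact: L.
move=> B /(_ B) A1.
have A2 : `|c| * `|f w - f w' - lin2 l w w'| <= e / 2 * dist1 w w'.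
  apply: (@le_trans _ _ ((`|c| + 1) * (e / 2 / (`|c| + 1) * dist1 w w'))).
    by apply: ler_pM; rewrite ?normr_ge0 ?lerDl // F4.
  by rewrite mulrA [_ * (e / 2 / _)]mulrC divfK // gt_eqF.
by rewrite (le_trans (lerD A1 A2)) // -mulrDl -splitr.
Qed.

Lemma strict_diffM f g z l m : strict_diff f z l -> strict_diff g z m ->
  strict_diff (fun w => f w * g w) z
    (f z * m.1 + g z * l.1, f z * m.2 + g z * l.2).
Proof.
move=> fl gm e e0.
pose Lm := `|m.1| + `|m.2|; pose Ll := `|l.1| + `|l.2|.
pose C := `|f z| + `|g z| + Lm + Ll + 2.
have Lm0 : 0 <= Lm by rewrite addr_ge0.
have Ll0 : 0 <= Ll by rewrite addr_ge0.
have C0 : 0 < C.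
  by rewrite /C ltr_wpDl // !addr_ge0.
pose e' := Order.min 1 (e / 4 / C).
have e'0 : 0 < e' by rewrite lt_min ltr01 !divr_gt0.
have [d1 d10 F] := fl _ e'0; have [d2 d20 G] := gm _ e'0.
have [d3 d30 F'] := strict_diff_cont fl e'0.
have [d4 d40 G'] := strict_diff_cont gm e'0.
exists (Order.min (Order.min d1 d2) (Order.min d3 d4)).
  by rewrite !lt_min d10 d20 d30 d40.
move=> w w'; rewrite !lt_min.
move=> /andP[/andP[w1 w2] /andP[w3 w4]] /andP[/andP[v1 v2] /andP[v3 v4]].
have -> : f w * g w - f w' * g w' -
    lin2 (f z * m.1 + g z * l.1, f z * m.2 + g z * l.2) w w' =
  (f w * (g w - g w' - lin2 m w w') + g w' * (f w - f w' - lin2 l w w'))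
  + ((f w - f z) * lin2 m w w' + (g w' - g z) * lin2 l w w').
  by rewrite /lin2 /=; ring.
have D0 := dist1_ge0 w w'; set D := dist1 w w' in D0 *.
have e'1 : e' <= 1 by rewrite ge_min lexx.
have e'C : C * e' <= e / 4.
  by rewrite mulrC -ler_pdivlMr // ge_min lexx orbT.
have CD a b : 0 <= a <= C -> 0 <= b <= e' * D -> a * b <= e / 4 * D.
  move=> /andP[a0 aC] /andP[b0 be].
  rewrite (le_trans (ler_pM a0 b0 aC be)) // mulrA.
  exact: ler_wpM2r.
have fC : `|f w| <= C.
  rewrite -(subrK (f z) (f w)) (le_trans (ler_normD _ _)) //.
  have := F' _ w3; rewrite /C; move: (`|f w - f z|) => a; have := normr_ge0 (g z).
  by lra.
have gC : `|g w'| <= C.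
  rewrite -(subrK (g z) (g w')) (le_trans (ler_normD _ _)) //.
  have := G' _ v4; rewrite /C; move: (`|g w' - g z|) => a; have := normr_ge0 (f z).
  by lra.
have LmC : Lm <= C by rewrite /C; have := normr_ge0 (f z); have := normr_ge0 (g z); lra.
have LlC : Ll <= C by rewrite /C; have := normr_ge0 (f z); have := normr_ge0 (g z); lra.
have T1 : `|f w * (g w - g w' - lin2 m w w')| <= e / 4 * D.
  by rewrite normrM CD // ?normr_ge0 // G.
have T2 : `|g w' * (f w - f w' - lin2 l w w')| <= e / 4 * D.
  by rewrite normrM CD // ?normr_ge0 // F.
have sub a b L : 0 <= L <= C -> `|a| <= e' -> `|b| <= L * D -> `|a * b| <= e / 4 * D.
  move=> LC ae bL; rewrite normrM.
  rewrite (le_trans (ler_pM (normr_ge0 _) (normr_ge0 _) ae bL)) //.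
  by rewrite mulrCA CD // mulr_ge0 ?lexx // ltW.
have T3 : `|(f w - f z) * lin2 m w w'| <= e / 4 * D.
  by apply: (sub _ _ Lm); rewrite ?Lm0 // ?(ltW (F' _ w3)) ?lin2_le.
have T4 : `|(g w' - g z) * lin2 l w w'| <= e / 4 * D.
  by apply: (sub _ _ Ll); rewrite ?Ll0 // ?(ltW (G' _ v4)) ?lin2_le.
rewrite (le_trans (ler_normD _ _)) // (le_trans (lerD (ler_normD _ _) (ler_normD _ _))) //.
by move: T1 T2 T3 T4; lra.
Qed.

Lemma strict_diff1_C1 (f df : R -> R) (x : R) : (forall y : R, is_derive y (1 : R) f (df y)) ->
  {for x, continuous df} -> strict_diff1 f x (df x).
Proof.
move=> fdf dfc e e0.
have /nbhs_ballP [d /= d0 dE] : \forall y \near x, `|df x - df y| < e.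
  by have /cvgrPdist_lt := dfc; apply.
exists d => // y y'.
wlog yy' : y y' / y' <= y.
  move=> W yd yd'; have [|/ltW] := leP y' y; first by move=> ?; exact: W.
  move=> /W /(_ yd' yd); rewrite distrC.
  suff -> : f y - f y' - df x * (y - y') = - (f y' - f y - df x * (y' - y)).
    by rewrite normrN [`|y' - y|]distrC distrC.
  by ring.
move=> yd yd'.
have fc : {within `[y', y], continuous f}.
  apply: continuous_subspaceT => t; apply: differentiable_continuous.
  by apply/derivable1_diffP; exact: (@ex_derive _ _ _ _ _ _ _ (fdf t)).
have [c] := MVT_segment yy' (fun t _ => fdf t) fc.
rewrite in_itv /= => /andP[c1 c2] ->.
rewrite -mulrBl normrM ler_wpM2r // distrC ltW //; apply: dE.
rewrite -ball_normE /=; move: yd yd'.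
by rewrite !ltr_norml => /andP[? ?] /andP[? ?]; apply/andP; split; lra.
Qed.

Lemma strict_diff_fst z (f : R -> R) (c : R) : strict_diff1 f z.1 c ->
  strict_diff (fun w => f w.1) z (c, 0).
Proof.
move=> fc e e0; have [d d0 H] := fc e e0; exists d => // w w' wd wd'.
have le1 u : `|u.1 - z.1| <= dist1 u z by rewrite lerDl.
rewrite /lin2 /= mul0r addr0.
rewrite (le_trans (H _ _ _ _)) ?(le_lt_trans (le1 _)) //.
by rewrite ler_pM2l // lerDl.
Qed.

Lemma strict_diff_snd z (f : R -> R) (c : R) : strict_diff1 f z.2 c ->
  strict_diff (fun w => f w.2) z (0, c).
Proof.
move=> fc e e0; have [d d0 H] := fc e e0; exists d => // w w' wd wd'.
have le1 u : `|u.2 - z.2| <= dist1 u z by rewrite lerDr.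
rewrite /lin2 /= mul0r add0r.
rewrite (le_trans (H _ _ _ _)) ?(le_lt_trans (le1 _)) //.
by rewrite ler_pM2l // lerDr.
Qed.

End StrictDerivative.

Section SphereMap.
Local Open Scope classical_set_scope.
Context {R : realType}.
Local Notation E := 'rV[R]_3.
Implicit Types (h k : E -> R) (H K : S2 R -> R) (p q : S2 R) (x v : E).

Lemma is_derive_line h x v (t : R) : differentiable h (x + t *: v) ->
  is_derive t (1 : R) (fun s : R => h (x + s *: v)) ('D_v h (x + t *: v)).
Proof.
move=> dh; have dv : derivable h (x + t *: v) v by exact: diff_derivable.
have e : (fun s : R => s^-1 *: (((fun s : R => h (x + s *: v)) \o shift t) (s *: (1 : R))
     - h (x + t *: v))) =
   (fun s : R => s^-1 *: ((h \o shift (x + t *: v)) (s *: v) - h (x + t *: v))).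
  apply/funext => s /=; congr (_ *: (h _ - _)).
  by rewrite [s *: (1 : R)](mulr1 s) scalerDl addrCA.
by split; rewrite /derivable /derive e.
Qed.

Lemma derive_sumE h x v : differentiable h x ->
  'D_v h x = \sum_j v 0 j * partial h j x.
Proof.
move=> dh; rewrite deriveE // {1}(row_sum_delta v) linear_sum.
by apply: eq_bigr => j _; rewrite linearZ /= /partial deriveE.
Qed.

Lemma smooth_strict H p h : smooth_extension H p h -> forall e : R, 0 < e ->
  exists2 d, 0 < d & forall q r : S2 R,
    (forall i, `|(q : E) 0 i - (p : E) 0 i| < d) ->
    (forall i, `|(r : E) 0 i - (p : E) 0 i| < d) ->
  `|H q - H r - \sum_j ((q : E) 0 j - (r : E) 0 j) * partial h j p|
     <= e * \sum_j `|(q : E) 0 j - (r : E) 0 j|.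
Proof.
move=> hh e e0; have hc j := @partial_continuous R H p h j hh.
have [U [oU Up Uh hU]] := hh.
have dh x : U x -> differentiable h x by have [+ _] := Uh 1%N; apply.
have : \forall x \near (p : E), U x /\ forall j, `|partial h j p - partial h j x| < e.
  near=> x; split; first by near: x; exact: open_nbhs_nbhs.
  near: x; apply: filter_forall => j.
  by have /cvgrPdist_lt := hc j; apply.
move=> /nbhs_ballP [d /= d0 dU]; exists d => // q r qd rd.
pose v : E := (q : E) - (r : E).
have seg (t : R) : 0 <= t <= 1 -> ball (p : E) d ((r : E) + t *: v).
  move=> /andP[t0 t1]; split => // i j; rewrite (ord1 i) /ball /= !mxE.
  have := qd j; have := rd j; rewrite !ltr_norml => /andP[a1 a2] /andP[b1 b2].
  have conv (A B : R) : 0 < A -> 0 < B -> 0 < (1 - t) * A + t * B.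
    by move=> A0 B0; have [] := ltP t (1 / 2) => ?; nra.
  set q0 := (q : E) 0 j in b1 b2 *; set p0 := (p : E) 0 j in a1 a2 b1 b2 *.
  set r0 := (r : E) 0 j in a1 a2 *.
  have := conv (r0 - p0 + d) (q0 - p0 + d); have := conv (d - (r0 - p0)) (d - (q0 - p0)).
  move=> /(_ ltac:(lra) ltac:(lra)) C1 /(_ ltac:(lra) ltac:(lra)) C2.
  by apply/andP; split; nra.
have D (t : R) : 0 <= t <= 1 -> is_derive t (1 : R) (fun s : R => h ((r : E) + s *: v))
    ('D_v h ((r : E) + t *: v)).
  by move=> /seg /dU [Ut _]; apply: is_derive_line; exact: dh.
have [||c] := @MVT_segment R (fun s : R => h ((r : E) + s *: v))
  (fun t : R => 'D_v h ((r : E) + t *: v))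
   0 1 ler01.
- by move=> t; rewrite in_itv /= => /andP[t0 t1]; apply: D; rewrite !ltW.
- apply: derivable_within_continuous => t; rewrite in_itv /= => t01.
  exact: (@ex_derive _ _ _ _ _ _ _ (D t t01)).
rewrite in_itv /= => c01; have [Uc hcl] := dU _ (seg c c01).
rewrite subr0 mulr1 scale1r scale0r addr0 [(r : E) + v]addrC /v subrK -/v => hqr.
have s0 : 0 <= (0 : R) <= 1 by rewrite lexx ler01.
have s1 : 0 <= (1 : R) <= 1 by rewrite lexx ler01.
have [Ur _] := dU _ (seg 0 s0); have [Uq _] := dU _ (seg 1 s1).
move: Ur Uq; rewrite scale1r scale0r addr0 [(r : E) + v]addrC /v subrK -/v => Ur Uq.
rewrite -(hU q) // -(hU r) // hqr derive_sumE; last exact: dh.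
rewrite -sumrB (le_trans (ler_norm_sum _ _ _)) // mulr_sumr.
apply: ler_sum => j _; rewrite !mxE -mulrBr normrM mulrC.
by rewrite ler_wpM2r // distrC ltW.
Unshelve. all: by end_near.
Qed.

Lemma strict_diff_S2 H p h (c : 'I_3 -> R * R -> R) (l : 'I_3 -> R * R)
    (Q : R * R -> S2 R) z :
  (forall w i, (Q w : E) 0 i = c i w) -> (forall i, strict_diff (c i) z (l i)) ->
  Q z = p -> smooth_extension H p h ->
  strict_diff (fun w => H (Q w)) z
   (\sum_j (l j).1 * partial h j p, \sum_j (l j).2 * partial h j p).
Proof.
move=> Qc cl Qz hh e e0.
pose G := \sum_j `|partial h j p| + 1.
have G0 : 0 < G by rewrite ltr_wpDl // sumr_ge0.
pose L := \sum_j (`|(l j).1| + `|(l j).2| + 1).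
have L0 : 0 <= L by apply: sumr_ge0 => j _; rewrite !addr_ge0.
have [d1 d10 F1] := smooth_strict hh (e := e / 2 / (L + 1)) ltac:(by rewrite !divr_gt0 // ltr_wpDl).
have eall (P : 'I_3 -> R -> Prop) : (forall i, exists2 d, 0 < d & P i d) ->
    (forall i d d', 0 < d' -> d' <= d -> P i d -> P i d') ->
    exists2 d, 0 < d & forall i, P i d.
  move=> Pd Pm; have /choice [D DP] : forall i, exists d, 0 < d /\ P i d.
    by move=> i; have [d ? ?] := Pd i; exists d.
  have D0 : 0 < \big[Order.min/1]_i D i.
    by apply: lt_bigmin => // i _; have [] := DP i.
  exists (\big[Order.min/1]_i D i) => // i; have [_] := DP i.
  by apply: Pm => //; exact: bigmin_le.
have [d2 d20 F2] := eall (fun i d => forall w, dist1 w z < d -> `|c i w - c i z| < d1)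
  (fun i => strict_diff_cont (cl i) d10)
  ltac:(by move=> i d d' _ dd H' w wd; apply: H'; exact: lt_le_trans dd).
have [d3 d30 F3] := eall (fun i d => forall w w', dist1 w z < d -> dist1 w' z < d -> _)
  (fun i => strict_diff_lip (cl i))
  ltac:(by move=> i d d' _ dd H' w w' wd wd'; apply: H'; exact: lt_le_trans dd).
have [d4 d40 F4] := eall (fun i d => forall w w', dist1 w z < d -> dist1 w' z < d -> _)
  (fun i => cl i (e / 2 / G) ltac:(by rewrite !divr_gt0))
  ltac:(by move=> i d d' _ dd H' w w' wd wd'; apply: H'; exact: lt_le_trans dd).
exists (Order.min (Order.min d2 d3) d4); first by rewrite !lt_min d20 d30 d40.
move=> w w'; rewrite !lt_min => /andP[/andP[w2 w3] w4] /andP[/andP[v2 v3] v4].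
have := F1 (Q w) (Q w').
have near_p u : dist1 u z < d2 -> forall i, `|(Q u : E) 0 i - (p : E) 0 i| < d1.
  by move=> ud i; rewrite -Qz !Qc F2.
move=> /(_ (near_p _ w2) (near_p _ v2)).
under eq_bigr do rewrite !Qc.
under [X in _ <= _ * X -> _]eq_bigr do rewrite !Qc.
move=> A1.
have sumL : \sum_j `|c j w - c j w'| <= L * dist1 w w'.
  by rewrite /L mulr_suml; apply: ler_sum => j _; exact: F3.
have A1' : e / 2 / (L + 1) * \sum_j `|c j w - c j w'| <= e / 2 * dist1 w w'.
  rewrite -mulrA ler_wpM2l ?divr_ge0 ?(ltW e0) // mulrC ler_pdivrMr ?ltr_wpDl //.
  by rewrite (le_trans sumL) // mulrC ler_wpM2l ?dist1_ge0 // lerDl.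
have -> : H (Q w) - H (Q w') - lin2 (\sum_j (l j).1 * partial h j p,
     \sum_j (l j).2 * partial h j p) w w' =
   (H (Q w) - H (Q w') - \sum_j (c j w - c j w') * partial h j p)
   + \sum_j (c j w - c j w' - lin2 (l j) w w') * partial h j p.
  under [X in _ = _ + X]eq_bigr do rewrite mulrBl.
  rewrite sumrB addrA subrK /lin2 /= !mulr_suml -big_split /=.
  by congr (_ - _); apply: eq_bigr => j _; ring.
rewrite (le_trans (ler_normD _ _)) // [leRHS](_ : _ = e / 2 * dist1 w w' + e / 2 * dist1 w w').
  rewrite lerD ?(le_trans A1) // (le_trans (ler_norm_sum _ _ _)) //.
  apply: (@le_trans _ _ (\sum_j e / 2 / G * dist1 w w' * `|partial h j p|)).
    by apply: ler_sum => j _; rewrite normrM ler_wpM2r // F4.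
  rewrite -mulr_sumr mulrAC ler_wpM2r ?dist1_ge0 //.
  rewrite -(mulrA (e / 2)) ler_piMr ?divr_ge0 ?(ltW e0) // mulrC ler_pdivrMr // mul1r.
  by rewrite lerDl.
by rewrite -mulrDl -splitr.
Qed.

End SphereMap.

Section RankOneMaps.
Local Open Scope classical_set_scope.
Context {R : realType}.
Implicit Types (a b : R * R -> R) (z w : R * R) (l m : R * R).

Lemma cross_increment_small a b z l m : strict_diff a z l -> strict_diff b z m ->
  l.1 * m.2 = l.2 * m.1 -> forall e : R, 0 < e ->
  exists2 d, 0 < d & forall w1 w2 w3 w4,
    dist1 w1 z < d -> dist1 w2 z < d -> dist1 w3 z < d -> dist1 w4 z < d ->
  `|(a w1 - a w2) * (b w3 - b w4) - (a w3 - a w4) * (b w1 - b w2)|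
     <= e * (dist1 w1 w2 * dist1 w3 w4).
Proof.
move=> al bm lm e e0.
pose C := `|l.1| + `|l.2| + (`|m.1| + `|m.2|) + 1.
have C0 : 0 < C by rewrite ltr_wpDl // !addr_ge0.
have C40 : 0 < 4 * C by rewrite mulr_gt0.
have e'0 : 0 < e / (4 * C) by rewrite divr_gt0.
have [d1 d10 A] := al _ e'0; have [d2 d20 B] := bm _ e'0.
have [d3 d30 B'] := strict_diff_lip bm.
exists (Order.min (Order.min d1 d2) d3); first by rewrite !lt_min d10 d20 d30.
move=> w1 w2 w3 w4; rewrite !lt_min.
move=> /andP[/andP[a1 b1] c1] /andP[/andP[a2 b2] c2].
move=> /andP[/andP[a3 b3] c3] /andP[/andP[a4 b4] c4].
have -> : (a w1 - a w2) * (b w3 - b w4) - (a w3 - a w4) * (b w1 - b w2) =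
   (a w1 - a w2 - lin2 l w1 w2) * (b w3 - b w4)
 + (b w3 - b w4 - lin2 m w3 w4) * lin2 l w1 w2
 - ((a w3 - a w4 - lin2 l w3 w4) * (b w1 - b w2)
    + (b w1 - b w2 - lin2 m w1 w2) * lin2 l w3 w4)
 + (l.1 * m.2 - l.2 * m.1)
   * ((w1.1 - w2.1) * (w3.2 - w4.2) - (w1.2 - w2.2) * (w3.1 - w4.1)).
  by rewrite /lin2; ring.
rewrite lm subrr mul0r addr0.
have bd x y D D' : `|x| <= e / (4 * C) * D -> `|y| <= C * D' -> 0 <= D ->
    `|x * y| <= e / 4 * (D * D').
  move=> xD yD D0; rewrite normrM (le_trans (ler_pM _ _ xD yD)) //.
  by rewrite le_eqVlt; apply/orP; left; apply/eqP; field; rewrite gt_eqF.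
have lipb w w' : dist1 w z < d3 -> dist1 w' z < d3 -> `|b w - b w'| <= C * dist1 w w'.
  move=> wd wd'; rewrite (le_trans (B' _ _ wd wd')) // ler_wpM2r ?dist1_ge0 //.
  by rewrite /C lerD2r lerDr addr_ge0.
have lina w w' : `|lin2 l w w'| <= C * dist1 w w'.
  rewrite (le_trans (lin2_le _ _ _)) // ler_wpM2r ?dist1_ge0 //.
  by rewrite /C -addrA lerDl !addr_ge0.
have T1 := bd _ _ _ _ (A w1 w2 a1 a2) (lipb w3 w4 c3 c4) (dist1_ge0 _ _).
have T2 := bd _ _ _ _ (B w3 w4 b3 b4) (lina w1 w2) (dist1_ge0 _ _).
have T3 := bd _ _ _ _ (A w3 w4 a3 a4) (lipb w1 w2 c1 c2) (dist1_ge0 _ _).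
have T4 := bd _ _ _ _ (B w1 w2 b1 b2) (lina w3 w4) (dist1_ge0 _ _).
rewrite (le_trans (ler_normB _ _)) //.
rewrite (le_trans (lerD (ler_normD _ _) (ler_normD _ _))) //.
move: T1 T2 T3 T4; set D12 := dist1 w1 w2; set D34 := dist1 w3 w4.
move: (`|_ * _|) (`|_ * _|) (`|_ * _|) (`|_ * _|) => x1 x2 x3 x4.
by rewrite (mulrC D34); move: (D12 * D34) => D; lra.
Qed.

Lemma no_rank_one_triangle a b (T : R) : 0 < T ->
  (forall z, exists l m,
     [/\ strict_diff a z l, strict_diff b z m & l.1 * m.2 = l.2 * m.1]) ->
  (forall t, a (0, t) + b (0, t) = 1) -> (forall s, b (s, 0) = 0) ->
  (forall s, a (s, T) = 0) -> (forall t, a (T, t) = 0 /\ b (T, t) = 0) -> False.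
Proof.
move=> T0 dab s0 t0 tT sT.
pose e := 1 / (8 * T ^+ 2).
have e0 : 0 < e by rewrite divr_gt0 // mulr_gt0 // exprn_gt0.
pose small (n : nat) z := forall w1 w2 w3 w4,
  dist1 w1 z <= 2 * T / n.+1%:R -> dist1 w2 z <= 2 * T / n.+1%:R ->
  dist1 w3 z <= 2 * T / n.+1%:R -> dist1 w4 z <= 2 * T / n.+1%:R ->
  `|(a w1 - a w2) * (b w3 - b w4) - (a w3 - a w4) * (b w1 - b w2)|
     <= e * (dist1 w1 w2 * dist1 w3 w4).
have /compact_near_coveringP cK :=
  compact_setX (@segment_compact R 0 T) (@segment_compact R 0 T).
have [|N _ NP] := cK nat \oo small _.
  move=> z _; have [l [m [al bm lm]]] := dab z.
  have [d d0 H] := cross_increment_small al bm lm e0.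
  have d4 : 0 < d / 4 by rewrite divr_gt0.
  exists (ball z (d / 4), [set n | n.+1%:R^-1 < d / 2 / (2 * T)]).
    split; first exact: nbhsx_ballx.
    by apply: near_infty_natSinv_lt (PosNum _); rewrite !divr_gt0 // mulr_gt0.
  move=> [z' n] /= [[zz1 zz2] nd] w1 w2 w3 w4.
  have nd' : 2 * T / n.+1%:R < d / 2.
    by rewrite mulrC -ltr_pdivlMr // mulr_gt0.
  have near_z w : dist1 w z' <= 2 * T / n.+1%:R -> dist1 w z < d.
    move=> wz; move: zz1 zz2; rewrite /ball /= => zz1 zz2.
    have := ler_normD (w.1 - z'.1) (z'.1 - z.1); have := ler_normD (w.2 - z'.2) (z'.2 - z.2).
    rewrite !addrA !subrK; move: wz zz1 zz2; rewrite /dist1 [`|z.1 - _|]distrC [`|z.2 - _|]distrC.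
    by move: nd'; move: (2 * T / _) => D; lra.
  by move=> /near_z ? /near_z ? /near_z ? /near_z ?; apply: H.
have {}NP : forall z, 0 <= z.1 <= T -> 0 <= z.2 <= T -> small N z.
  by move=> z z1 z2; apply: (NP N) => //=; split; rewrite /= in_itv.
pose n := N.+1; pose x (i : nat) : R := T * i%:R / n%:R.
have n0 : 0 < n%:R :> R by rewrite ltr0n.
have xS i : x i.+1 = x i + T / n%:R by rewrite /x -natr1; ring.
have x0 : x 0%N = 0 by rewrite /x mulr0 mul0r.
have xn : x n = T by rewrite /x mulfK // gt_eqF.
have x_itv i : (i < n)%N -> 0 <= x i <= T.
  move=> ilt; rewrite /x divr_ge0 ?mulr_ge0 ?(ltW T0) //=.
  by rewrite ler_pdivrMr // ler_pM2l // ler_nat ltnW.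
pose P i j := (a (x i, x j), b (x i, x j)).
have Tn0 : 0 < T / n%:R by rewrite divr_gt0.
have small_cell i j : (i < n)%N -> (j < n)%N ->
    `|cell (P i j) (P i.+1 j) (P i.+1 j.+1) (P i j.+1)| <= 1 / 2 / n%:R / n%:R.
  move=> ilt jlt; rewrite cellE /=.
  have D u v : 0 <= u -> 0 <= v -> u + v <= 2 * (T / n%:R) ->
      dist1 (x i + u, x j + v) (x i, x j) <= 2 * T / n%:R.
    by move=> u0 v0 uv; rewrite /dist1 /= [x i + u - _]addrAC [x j + v - _]addrAC !subrr
      !add0r !ger0_norm // -mulrA.
  have := NP (x i, x j) (x_itv i ilt) (x_itv j jlt) (x i.+1, x j.+1) (x i, x j)
    (x i, x j.+1) (x i.+1, x j).
  rewrite !xS -/n.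
  have Tn0' := ltW Tn0.
  have := D (T / n%:R) (T / n%:R) Tn0' Tn0' ltac:(lra).
  have := D 0 0 (lexx _) (lexx _) ltac:(lra).
  have := D 0 (T / n%:R) (lexx _) Tn0' ltac:(lra).
  have := D (T / n%:R) 0 Tn0' (lexx _) ltac:(lra).
  rewrite !addr0 => D1 D2 D3 D4 /(_ D4 D3 D2 D1) => /le_trans; apply.
  set h := T / n%:R in Tn0 Tn0' *.
  rewrite /dist1 /= [x i + h - _]addrAC [x j + h - _]addrAC !subrr !add0r.
  rewrite opprD addrA subrr add0r normrN !ger0_norm //.
  rewrite le_eqVlt; apply/orP; left; apply/eqP; rewrite /e /h; field.
  by rewrite (gt_eqF T0) -/n gt_eqF.
have : \sum_(0 <= i < n) \sum_(0 <= j < n)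
    cell (P i j) (P i.+1 j) (P i.+1 j.+1) (P i j.+1) = -1.
  apply: sum_cells_triangle => [j|||i|i|j]; rewrite /P /= ?x0 ?xn //.
  - by rewrite -(s0 0) t0 addr0.
  - by have [-> ->] := sT (x j).
move=> /(congr1 (fun u => `|u|)); rewrite normrN1 => sum1.
suff : 1 <= 1 / 2 :> R by lra.
rewrite -[leLHS]sum1 (le_trans (ler_norm_sum _ _ _)) //.
apply: (@le_trans _ _ (\sum_(0 <= i < n) \sum_(0 <= j < n) 1 / 2 / n%:R / n%:R)).
  rewrite !big_mkord; apply: ler_sum => i _.
  rewrite (le_trans (ler_norm_sum _ _ _)) // !big_mkord.
  by apply: ler_sum => j _; exact: small_cell.
rewrite !sumr_const_nat subn0 -[leLHS]mulr_natr -[X in X * n%:R <= _]mulr_natr.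
by rewrite !divfK // gt_eqF.
Qed.

End RankOneMaps.

(** * The lower bound on the distance to commuting pairs *)

Section LowerBound.
Local Open Scope classical_set_scope.
Context {R : realType}.
Local Notation E := 'rV[R]_3.
Implicit Types (H K : S2 R -> R) (z w l : R * R).

Definition sqpos (t : R) : R := Order.max t 0 ^+ 2.

Definition step (t : R) : R := 1 - sqpos (1 - sqpos t).

Lemma step_le0 t : t <= 0 -> step t = 0.
Proof.
move=> t0; rewrite /step /sqpos (max_r t0) expr0n /= subr0.
by rewrite max_l ?ler01 // expr1n subrr.
Qed.

Lemma step_ge1 t : 1 <= t -> step t = 1.
Proof.
move=> t1; have t0 : 0 <= t by rewrite (le_trans _ t1).
rewrite /step /sqpos (max_l t0) max_r ?expr0n /= ?subr0 //.
by rewrite subr_le0 exprn_ege1.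
Qed.

Lemma strict_diff1_sqpos (x : R) : strict_diff1 sqpos x (2 * Order.max x 0).
Proof.
move=> e e0; exists (e / 2); first by rewrite divr_gt0.
move=> y y'.
wlog yy' : y y' / y' <= y.
  move=> W yd yd'; have [|/ltW] := leP y' y; first by move=> ?; exact: W.
  move=> /W /(_ yd' yd); rewrite distrC.
  suff -> : sqpos y - sqpos y' - 2 * Order.max x 0 * (y - y') =
     - (sqpos y' - sqpos y - 2 * Order.max x 0 * (y' - y)).
    by rewrite normrN [`|y' - y|]distrC distrC.
  by ring.
rewrite /sqpos [`|y - y'|]ger0_norm ?subr_ge0 // !ltr_norml ler_norml.
move=> /andP[y1 y2] /andP[y1' y2'].
have [? ? ?] : [/\ Order.max x 0 - e / 2 <= Order.max y' 0,
  Order.max y' 0 <= Order.max y 0 & Order.max y 0 <= Order.max x 0 + e / 2].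
  by split; have [] := leP x 0; have [] := leP y 0; have [] := leP y' 0; lra.
have C1 : 2 * Order.max y' 0 * (y - y') <= Order.max y 0 ^+ 2 - Order.max y' 0 ^+ 2.
  by have [] := leP y 0; have [] := leP y' 0; nra.
have C2 : Order.max y 0 ^+ 2 - Order.max y' 0 ^+ 2 <= 2 * Order.max y 0 * (y - y').
  by have [] := leP y 0; have [] := leP y' 0; nra.
by apply/andP; split; nra.
Qed.

Lemma strict_diff1_affine (u v x : R) : strict_diff1 (fun y => u * y + v) x u.
Proof.
move=> e e0; exists 1 => // y y' _ _.
have -> : u * y + v - (u * y' + v) - u * (y - y') = 0 by ring.
by rewrite normr0 mulr_ge0 // ltW.
Qed.

Lemma strict_diff_step (f : R * R -> R) z l (u v : R) : strict_diff f z l ->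
  exists c, strict_diff (fun w => step (u * f w + v)) z (c * l.1, c * l.2).
Proof.
move=> fl.
have s1 := strict_diff_comp1 fl (strict_diff1_affine u v (f z)).
have s2 := strict_diff_comp1 s1 (strict_diff1_sqpos _).
have s3 := strict_diff_comp1 s2 (strict_diff1_affine (-1) 1 _).
have s4 := strict_diff_comp1 s3 (strict_diff1_sqpos _).
have s5 := strict_diff_comp1 s4 (strict_diff1_affine (-1) 1 _).
move: s5; rewrite /= !mulrA; set c := _ * u => s5; exists c.
rewrite (_ : (fun w => _) = (fun y => -1 * y + 1) \o (sqpos \o ((fun y => -1 * y + 1) \o
  (sqpos \o ((fun y => u * y + v) \o f))))) //.
by apply/funext => w; rewrite /step /= !mulN1r ![- _ + 1]addrC.
Qed.

Definition spherical_vec w : E :=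
  \row_j [:: cos w.1 * cos w.2; cos w.1 * sin w.2; sin w.1]`_j.

Lemma spherical_vecP w : dot3 (spherical_vec w) (spherical_vec w) = 1.
Proof.
rewrite dot3E !mxE /=.
transitivity (cos w.1 ^+ 2 * (cos w.2 ^+ 2 + sin w.2 ^+ 2) + sin w.1 ^+ 2); first by ring.
by rewrite cos2Dsin2 mulr1 cos2Dsin2.
Qed.

Definition spherical w : S2 R := MkS2 (spherical_vecP w).

Lemma strict_diff1_cos (x : R) : strict_diff1 cos x (- sin x).
Proof.
apply: (@strict_diff1_C1 R cos (fun y => - sin y)).
by apply: continuousN; exact: continuous_sin.
Qed.

Lemma strict_diff1_sin (x : R) : strict_diff1 sin x (cos x).
Proof. by apply: (@strict_diff1_C1 R sin cos); exact: continuous_cos. Qed.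

Definition dspherical z (j : 'I_3) : R * R := nth (0, 0)
  [:: (cos z.1 * 0 + cos z.2 * - sin z.1, cos z.1 * - sin z.2 + cos z.2 * 0);
      (cos z.1 * 0 + sin z.2 * - sin z.1, cos z.1 * cos z.2 + sin z.2 * 0);
      (cos z.1, 0)] j.

Lemma strict_diff_spherical z (j : 'I_3) :
  strict_diff (fun w => [:: cos w.1 * cos w.2; cos w.1 * sin w.2; sin w.1]`_j) z
    (dspherical z j).
Proof.
have c1 := strict_diff_fst (strict_diff1_cos z.1).
have s1 := strict_diff_fst (strict_diff1_sin z.1).
have c2 := strict_diff_snd (strict_diff1_cos z.2).
have s2 := strict_diff_snd (strict_diff1_sin z.2).
case: j => [[|[|[|//]]] i] /=; rewrite /dspherical /=.
- exact: (strict_diffM c1 c2).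
- exact: (strict_diffM c1 s2).
- exact: s1.
Qed.

Lemma strict_diff_commuting H K z : smooth H -> smooth K ->
  (forall p, poisson H K p = 0) -> exists l m,
  [/\ strict_diff (fun w => H (spherical w)) z l,
      strict_diff (fun w => K (spherical w)) z m & l.1 * m.2 = l.2 * m.1].
Proof.
move=> sH sK HK0; have [h hh] := sH (spherical z); have [k kk] := sK (spherical z).
have SP w i : (spherical w : E) 0 i =
    (fun (i : 'I_3) w => [:: cos w.1 * cos w.2; cos w.1 * sin w.2; sin w.1]`_i) i w.
  by rewrite mxE.
have dH := strict_diff_S2 SP (strict_diff_spherical z) erefl hh.
have dK := strict_diff_S2 SP (strict_diff_spherical z) erefl kk.
do 2 eexists; split; [exact: dH|exact: dK|].
have := poissonE hh kk; rewrite HK0 => /eqP; rewrite eq_sym oppr_eq0 => /eqP B0.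
rewrite /= !big_ord_recr !big_ord0 /= !add0r.
have o0 : widen_ord (leqnSn 2) (widen_ord (leqnSn 1) ord_max) = 0 :> 'I_3
  by exact: val_inj.
have o1 : widen_ord (leqnSn 2) ord_max = 1 :> 'I_3 by exact: val_inj.
have o2 : ord_max = 2%:R :> 'I_3 by exact: val_inj.
rewrite o0 o1 o2; move: B0; rewrite /ambient_bracket !mxE /dspherical /=.
set h0 := partial h 0 _; set h1 := partial h 1 _; set h2 := partial h 2%:R _.
set k0 := partial k 0 _; set k1 := partial k 1 _; set k2 := partial k 2%:R _.
move=> B0; apply/eqP; rewrite -subr_eq0; apply/eqP.
have := cos2Dsin2 z.2; move: B0.
set C := cos z.1; set S := sin z.1; set c := cos z.2; set s := sin z.2 => B0 cs.
transitivity (- C * (C * c * (h1 * k2 - h2 * k1) + C * s * (h2 * k0 - h0 * k2)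
   + S * (h0 * k1 - h1 * k0)) + C * S * (1 - (c ^+ 2 + s ^+ 2)) * (h0 * k1 - h1 * k0)).
  by ring.
by rewrite B0 cs subrr !mulr0 mul0r addr0.
Qed.

Lemma commuting_dist_lower_bound H K (a b : R) : smooth H -> smooth K ->
  (forall p, poisson H K p = 0) ->
  (forall p : S2 R, `|(p : E) 0 0 ^+ 2 - H p| <= a) ->
  (forall p : S2 R, `|(p : E) 0 1 ^+ 2 - K p| <= b) -> 1 / 2 <= a + b.
Proof.
move=> sH sK HK0 Ha Kb; rewrite leNgt; apply/negP => ab.
pose d := (1 - 2 * a - 2 * b) / 2.
have d0 : 0 < d by rewrite /d; lra.
pose A w := step (d^-1 * H (spherical w) + (- a / d)).
pose B w := step (d^-1 * K (spherical w) + (- b / d)).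
have AE w : A w = step ((H (spherical w) - a) / d) by congr step; rewrite mulrBl mulNr mulrC.
have BE w : B w = step ((K (spherical w) - b) / d) by congr step; rewrite mulrBl mulNr mulrC.
have A0 w : (spherical w : E) 0 0 = 0 -> A w = 0.
  move=> x0; rewrite AE; apply: step_le0; rewrite ler_pdivrMr // mul0r.
  by have := Ha (spherical w); rewrite x0 expr0n sub0r normrN ler_norml => /andP[]; lra.
have B0 w : (spherical w : E) 0 1 = 0 -> B w = 0.
  move=> y0; rewrite BE; apply: step_le0; rewrite ler_pdivrMr // mul0r.
  by have := Kb (spherical w); rewrite y0 expr0n sub0r normrN ler_norml => /andP[]; lra.
have AB w : (spherical w : E) 0 2%:R = 0 -> A w = 1 \/ B w = 1.
  move=> z0; have := S2valP (spherical w); rewrite dot3E z0 mulr0 addr0 => xy.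
  have [Hd|Hd] := leP (a + d) (H (spherical w)); [left|right].
    by rewrite AE; apply: step_ge1; rewrite ler_pdivlMr //; lra.
  rewrite BE; apply: step_ge1; rewrite ler_pdivlMr // mul1r.
  have := Ha (spherical w); have := Kb (spherical w).
  rewrite !expr2 !ler_norml => /andP[K1 K2] /andP[H1 H2].
  by rewrite /d in Hd *; lra.
apply: (@no_rank_one_triangle R (fun w => A w * (- (1 / 2) * B w + 1))
  (fun w => B w * (- (1 / 2) * A w + 1)) (pi / 2)).
- by rewrite divr_gt0 // pi_gt0.
- move=> z; have [l [m [dH dK lm]]] := strict_diff_commuting z sH sK HK0.
  have [c1 dA] := strict_diff_step d^-1 (- a / d) dH.
  have [c2 dB] := strict_diff_step d^-1 (- b / d) dK.
  have dB' := strict_diff_comp1 dB (strict_diff1_affine (- (1 / 2)) 1 _).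
  have dA' := strict_diff_comp1 dA (strict_diff1_affine (- (1 / 2)) 1 _).
  do 2 eexists; split; [exact: (strict_diffM dA dB')|exact: (strict_diffM dB dA')|].
  rewrite /=; apply/eqP; rewrite -subr_eq0; apply/eqP.
  set A1 := step _; set B1 := step _.
  transitivity (((- (1 / 2) * B1 + 1) * (- (1 / 2) * A1 + 1) - A1 * B1 / 4)
    * (c1 * c2) * (l.1 * m.2 - l.2 * m.1)); first by field.
  by rewrite lm subrr mulr0.
- move=> t; have [|->|->] := AB (0, t); first by rewrite mxE /= sin0.
    by field.
  by field.
- by move=> s; rewrite B0 ?mul0r // mxE /= sin0 mulr0.
- by move=> s; rewrite A0 ?mul0r // mxE /= cos_pihalf mulr0.
- by move=> t; rewrite A0 ?B0 ?mul0r // mxE /= cos_pihalf mul0r.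
Qed.

End LowerBound.

(** * Nearly commuting approximations *)

Section ModelFunctions.
Context {R : realType}.
Variable tau : R.
Hypotheses (tau0 : 0 < tau) (tau1 : tau <= 1 / 200).
Implicit Types u v : R.

Definition smooth_abs u : R := Num.sqrt ((1 / 2 + 2 * tau - u) ^+ 2 + (tau ^+ 3) ^+ 2).

Definition ramp_down u : R := (smooth_abs u + (1 / 2 + 2 * tau - u)) / 2.

Definition ramp_up u : R := (smooth_abs u - (1 / 2 + 2 * tau - u)) / 2.

(* [ramp_down] and [ramp_up] are smoothings of the positive and negative parts of
   [1 / 2 + 2 * tau - u]; their product is [tau ^ 6 / 4].  The quotients
   [ramp_down v / (ramp_down u + ramp_down v)] and the one with [u] and [v]
   exchanged sum to 1, so they have rank one as a pair; the quadratic factor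
   pulls them down to nearly 0 at [u = 0] and [v = 0]. *)
Definition model u v : R :=
  1 / 4 - tau / 4
  + 4 * tau * (ramp_down v * (1 - 4 * ramp_down u ^+ 2)
               / (ramp_down u + ramp_down v))
  + ramp_up u.

Lemma tau3_gt0 : 0 < tau ^+ 3.
Proof. exact: exprn_gt0. Qed.

Lemma smooth_abs_arg_gt0 u : 0 < (1 / 2 + 2 * tau - u) ^+ 2 + (tau ^+ 3) ^+ 2.
Proof. by rewrite ltr_wpDl ?sqr_ge0 // exprn_gt0 // tau3_gt0. Qed.

Lemma smooth_abs_gt0 u : 0 < smooth_abs u.
Proof. by rewrite sqrtr_gt0 smooth_abs_arg_gt0. Qed.

Lemma sqr_smooth_abs u : smooth_abs u ^+ 2 = (1 / 2 + 2 * tau - u) ^+ 2 + (tau ^+ 3) ^+ 2.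
Proof. by rewrite sqr_sqrtr // ltW // smooth_abs_arg_gt0. Qed.

Lemma smooth_abs_ge u : `|1 / 2 + 2 * tau - u| < smooth_abs u /\ tau ^+ 3 <= smooth_abs u.
Proof.
have h0 := smooth_abs_gt0 u; have h2 := sqr_smooth_abs u; have t3 := tau3_gt0; split.
  by rewrite -(@ltr_sqr _ `|_|) ?nnegrE ?(ltW h0) // real_normK ?num_real // h2
    ltrDl exprn_gt0.
by rewrite -(@ler_sqr _ (tau ^+ 3)) ?nnegrE ?(ltW h0) ?(ltW t3) // h2 lerDr sqr_ge0.
Qed.

Lemma smooth_abs_le u : smooth_abs u <= `|1 / 2 + 2 * tau - u| + tau ^+ 3.
Proof.
have t3 := tau3_gt0; have a0 := normr_ge0 (1 / 2 + 2 * tau - u).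
rewrite -(@ler_sqr _ (smooth_abs u)) ?nnegrE ?(ltW (smooth_abs_gt0 u)) ?addr_ge0 // ?(ltW t3) //.
rewrite sqr_smooth_abs -(real_normK (num_real (1 / 2 + 2 * tau - u))) sqrrD.
by rewrite lerD2r lerDl mulrn_wge0 // mulr_ge0 // ltW.
Qed.

Lemma ramp_down_gt0 u : 0 < ramp_down u.
Proof.
have [] := smooth_abs_ge u; rewrite ltr_norml => /andP[a b] _.
by rewrite /ramp_down; lra.
Qed.

Lemma ramp_up_gt0 u : 0 < ramp_up u.
Proof.
have [] := smooth_abs_ge u; rewrite ltr_norml => /andP[a b] _.
by rewrite /ramp_up; lra.
Qed.

Lemma ramp_upE u : ramp_up u = ramp_down u - (1 / 2 + 2 * tau - u).
Proof. by rewrite /ramp_up /ramp_down; field. Qed.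

Lemma ramp_prod u : ramp_down u * ramp_up u = (tau ^+ 3) ^+ 2 / 4.
Proof.
transitivity ((smooth_abs u ^+ 2 - (1 / 2 + 2 * tau - u) ^+ 2) / 4).
  by rewrite /ramp_up /ramp_down; field.
by rewrite sqr_smooth_abs; field.
Qed.

Lemma ramp_sum u : ramp_down u + ramp_up u = smooth_abs u.
Proof. by rewrite /ramp_up /ramp_down; field. Qed.

Lemma ramp_down_sum_ge u v : u + v <= 1 -> 4 * tau <= ramp_down u + ramp_down v.
Proof.
have := ramp_up_gt0 u; have := ramp_up_gt0 v; rewrite !ramp_upE.
by lra.
Qed.

Lemma tau3_le : tau ^+ 3 <= tau / 200.
Proof.
have t0 := tau0; have t1 := tau1.
rewrite exprS ler_pM2l // expr2.
have : tau * tau <= 1 * (1 / 200) by apply: ler_pM; lra.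
by lra.
Qed.

Lemma ramp_down_le u : 0 <= u <= 1 -> ramp_down u <= 1 / 2 + 3 * tau.
Proof.
have t0 := tau0; have t1 := tau1.
move=> /andP[u0 u1]; have := smooth_abs_le u; have := tau3_le; rewrite /ramp_down.
have [?|?] := leP 0 (1 / 2 + 2 * tau - u).
  by rewrite ger0_norm //; lra.
by rewrite ltr0_norm //; lra.
Qed.

Lemma ramp_up_le u : 0 <= u <= 1 ->
  ramp_up u <= Num.max (u - (1 / 2 + 2 * tau)) 0 + tau / 200.
Proof.
have t0 := tau0; have t1 := tau1.
move=> /andP[u0 u1]; have := smooth_abs_le u; have := tau3_le; rewrite /ramp_up.
have [?|?] := leP 0 (1 / 2 + 2 * tau - u).
  by rewrite ger0_norm // max_r; lra.
by rewrite ltr0_norm // max_l; lra.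
Qed.

Lemma model_dist u v : 0 <= u -> 0 <= v -> u + v <= 1 ->
  `|u - model u v| <= 1 / 4 - tau / 8.
Proof.
have t0 := tau0; have t1 := tau1.
move=> u0 v0 uv; have u01 : 0 <= u <= 1 by lra.
rewrite /model ramp_upE.
have Qup := ramp_up_le u01; have Q0 := ramp_up_gt0 u; rewrite ramp_upE in Qup Q0.
have Xup := ramp_down_le u01; have X0 := ramp_down_gt0 u; have Y0 := ramp_down_gt0 v.
have W4 := ramp_down_sum_ge uv.
set X := ramp_down u in Qup Q0 Xup X0 W4 *; set Y := ramp_down v in Y0 W4 *.
have W0 : 0 < X + Y by exact: addr_gt0.
pose m := 1 - 4 * X ^+ 2; pose r := Y / (X + Y).
have -> : Y * (1 - 4 * X ^+ 2) / (X + Y) = r * m.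
  by rewrite /r /m; field; rewrite gt_eqF.
have r0 : 0 <= r by rewrite divr_ge0 // ltW.
have r1 : r <= 1 by rewrite ler_pdivrMr // mul1r lerDr ltW.
have m1 : m <= 1 by rewrite /m; nra.
have m4u : m <= 4 * u.
  have [?|?] := leP u (1 / 2); last by lra.
  by rewrite /m; nra.
have m13 : - (13 * tau) <= m.
  have : X ^+ 2 <= (1 / 2 + 3 * tau) ^+ 2 by rewrite ler_pXn2r // ?nnegrE; lra.
  by rewrite /m; nra.
have rm1 : r * m <= 1 by nra.
have rm4u : r * m <= 4 * u by nra.
have rm13 : - (13 * tau) <= r * m by nra.
have rX : 4 * tau - X <= 4 * tau * r.
  by rewrite /r mulrA ler_pdivlMr //; nra.
rewrite ler_norml; apply/andP; split.
  have [ud|ud] := leP u (1 / 2 + 2 * tau).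
    move: Qup; rewrite max_r; last by lra.
    have : tau * (r * m) <= tau * (4 * u) by rewrite ler_pM2l.
    by nra.
  move: Qup; rewrite max_l; last by lra.
  have : tau * (r * m) <= tau * 1 by rewrite ler_pM2l.
  by nra.
suff : 19 / 8 * tau <= 4 * tau * (r * m) + X by lra.
have [X3|X3] := leP (3 * tau) X; first by nra.
have m36 : 9 / 10 <= m.
  have : X ^+ 2 <= (3 * tau) ^+ 2 by rewrite ler_pXn2r // ?nnegrE; lra.
  by rewrite /m; nra.
have : (4 * tau - X) * (9 / 10) <= 4 * tau * r * m by apply: ler_pM; lra.
by lra.
Qed.

End ModelFunctions.

Section ModelJacobian.
Context {R : realType}.
Variable tau : R.
Hypotheses (tau0 : 0 < tau) (tau1 : tau <= 1 / 200).
Implicit Types u v : R.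
Local Notation smooth_abs := (smooth_abs tau).
Local Notation ramp_down := (ramp_down tau).
Local Notation ramp_up := (ramp_up tau).
Local Notation model := (model tau).

Definition model_u u v : R :=
  4 * tau * (8 * ramp_down u * ramp_down v / (ramp_down u + ramp_down v)
    + ramp_down v * (1 - 4 * ramp_down u ^+ 2) / (ramp_down u + ramp_down v) ^+ 2)
    * (ramp_down u / smooth_abs u)
  + ramp_up u / smooth_abs u.

Definition model_v u v : R :=
  - (4 * tau * ((1 - 4 * ramp_down u ^+ 2) * ramp_down u
                / (ramp_down u + ramp_down v) ^+ 2)) * (ramp_down v / smooth_abs v).

Lemma ramp_down_frac u : 0 <= ramp_down u / smooth_abs u <= 1.
Proof.
have h0 := smooth_abs_gt0 tau0 u; have D0 := ltW (ramp_down_gt0 tau0 u).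
rewrite (divr_ge0 D0 (ltW h0)) /= ler_pdivrMr // mul1r -ramp_sum lerDl.
exact: ltW (ramp_up_gt0 tau0 u).
Qed.

Lemma ramp_up_frac u : 0 <= ramp_up u / smooth_abs u <= 1.
Proof.
have h0 := smooth_abs_gt0 tau0 u; have Q0 := ltW (ramp_up_gt0 tau0 u).
rewrite (divr_ge0 Q0 (ltW h0)) /= ler_pdivrMr // mul1r -ramp_sum lerDr.
exact: ltW (ramp_down_gt0 tau0 u).
Qed.

Lemma ramp_overlap u : ramp_down u * (ramp_up u / smooth_abs u) <= tau ^+ 3 / 4.
Proof.
have t0 := tau0; have t1 := tau1.
have h0 := smooth_abs_gt0 tau0 u; have [_ he] := smooth_abs_ge tau0 u.
rewrite mulrA ramp_prod // ler_pdivrMr //; have := tau3_gt0 tau0.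
by set t := tau ^+ 3 in he *; nra.
Qed.

Lemma ramp_up_frac_small u : u <= 1 / 2 -> ramp_up u / smooth_abs u <= tau ^+ 2.
Proof.
have t0 := tau0; have t1 := tau1.
move=> u2; have h0 := smooth_abs_gt0 tau0 u; have D0 := ramp_down_gt0 tau0 u.
have Q0 := ramp_up_gt0 tau0 u.
have := ramp_upE tau u; have := ramp_prod tau0 u; have := ramp_sum tau u.
set D := ramp_down u in D0 *; set Q := ramp_up u in Q0 *.
move=> S DQ QE; have D2 : 2 * tau <= D by lra.
rewrite ler_pdivrMr // -S.
have t2 : tau ^+ 2 <= 1 by nra.
have : D * Q <= D * (tau ^+ 2 * (D + Q)).
  rewrite DQ (_ : _ / 4 = tau ^+ 2 * (tau ^+ 2 * tau ^+ 2 / 4)); last by field.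
  apply: (@le_trans _ _ (tau ^+ 2 * (D * D))).
    rewrite ler_pM2l ?exprn_gt0 //.
    have : 2 * tau * (2 * tau) <= D * D by apply: ler_pM; lra.
    have : tau ^+ 2 * tau ^+ 2 <= tau ^+ 2 * 1 by rewrite ler_pM2l ?exprn_gt0.
    by nra.
  by rewrite [leRHS]mulrCA ler_pM2l ?exprn_gt0 // ler_pM2l // lerDl ltW.
by rewrite ler_pM2l.
Qed.

Lemma model_jacobian u v : 0 <= u -> 0 <= v -> u + v <= 1 ->
  `|model_u u v * model_u v u - model_v u v * model_v v u| <= 150 * tau ^+ 2.
Proof.
have t0 := tau0; have t1 := tau1.
move=> u0 v0 uv; rewrite /model_u /model_v [ramp_down v + ramp_down u]addrC.
have /andP[a0 a1] := ramp_down_frac u; have /andP[b0 b1] := ramp_down_frac v.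
have /andP[p0 p1] := ramp_up_frac u; have /andP[q0 q1] := ramp_up_frac v.
have Xp := ramp_overlap u; have Yq := ramp_overlap v.
have pq : (ramp_up u / smooth_abs u) * (ramp_up v / smooth_abs v) <= tau ^+ 2.
  have [u2|u2] := leP u (1 / 2).
    by have := ramp_up_frac_small u2; nra.
  have v2 : v <= 1 / 2 by lra.
  by have := ramp_up_frac_small v2; nra.
have X0 := ramp_down_gt0 tau0 u; have Y0 := ramp_down_gt0 tau0 v.
have X1 : ramp_down u <= 1 / 2 + 3 * tau by apply: (ramp_down_le tau0 tau1); lra.
have Y1 : ramp_down v <= 1 / 2 + 3 * tau by apply: (ramp_down_le tau0 tau1); lra.
have W4 := ramp_down_sum_ge tau0 uv.
move: (ramp_down u / _) (ramp_down v / _) (ramp_up u / _) (ramp_up v / _)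
  a0 a1 b0 b1 p0 p1 q0 q1 Xp Yq pq => a b p q a0 a1 b0 b1 p0 p1 q0 q1 Xp Yq pq.
move: (ramp_down u) (ramp_down v) X0 Y0 X1 Y1 W4 Xp Yq => X Y X0 Y0 X1 Y1 W4 Xp Yq.
have W0 : 0 < X + Y by exact: addr_gt0.
have m1 : `|1 - 4 * X ^+ 2| <= 1 by rewrite ler_norml; apply/andP; split; nra.
have n1 : `|1 - 4 * Y ^+ 2| <= 1 by rewrite ler_norml; apply/andP; split; nra.
move: (1 - 4 * X ^+ 2) (1 - 4 * Y ^+ 2) m1 n1 => m n m1 n1.
pose x := X / (X + Y); pose y := Y / (X + Y); pose w := (X + Y)^-1.
have w0 : 0 < w by rewrite invr_gt0.
have x0 : 0 <= x by rewrite divr_ge0 // ltW.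
have y0 : 0 <= y by rewrite divr_ge0 // ltW.
have xy1 : x + y = 1 by rewrite /x /y -mulrDl divff // gt_eqF.
have tw : 4 * tau * w <= 1 by rewrite /w ler_pdivrMr // mul1r.
(* The products of the two terms in [(X + Y) ^- 2] cancel: they form the
   Jacobian of the pair of quotients summing to 1. *)
have -> : (4 * tau * (8 * X * Y / (X + Y) + Y * m / (X + Y) ^+ 2) * a + p)
  * (4 * tau * (8 * Y * X / (X + Y) + X * n / (X + Y) ^+ 2) * b + q)
  - - (4 * tau * (m * X / (X + Y) ^+ 2)) * b * (- (4 * tau * (n * Y / (X + Y) ^+ 2)) * a)
  = 16 * tau ^+ 2 * (a * b) * (64 * (X * Y) * (x * y) + 8 * (x * y) * (x * n + y * m))
  + 4 * tau * (X * p) * (8 * y + n * w ^+ 2) * b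
  + 4 * tau * (Y * q) * (8 * x + m * w ^+ 2) * a + p * q.
  by rewrite /x /y /w; field; rewrite gt_eqF.
clearbody x y w.
have ab0 : 0 <= a * b by exact: mulr_ge0.
have ab1 : a * b <= 1 by nra.
have xy4 : x * y <= 1 / 4 by have := sqr_ge0 (x - y); nra.
have xy0 : 0 <= x * y by exact: mulr_ge0.
have XY : X * Y <= 36 / 100 by nra.
have XY0 : 0 <= X * Y by rewrite mulr_ge0 // ltW.
have T1 : `|16 * tau ^+ 2 * (a * b) * (64 * (X * Y) * (x * y) + 8 * (x * y) * (x * n + y * m))|
    <= 16 * tau ^+ 2 * 8.
  have s0 : 0 <= 16 * tau ^+ 2 by rewrite mulr_ge0 // sqr_ge0.
  have e0 : 0 <= 16 * tau ^+ 2 * (a * b) by rewrite mulr_ge0.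
  rewrite normrM (ger0_norm e0); apply: ler_pM => //.
    by rewrite ler_piMr.
  have c1 : `|x * n + y * m| <= 1.
    rewrite (le_trans (ler_normD _ _)) // !normrM (ger0_norm x0) (ger0_norm y0).
    by nra.
  have A0 : 0 <= 64 * (X * Y) * (x * y) by apply: mulr_ge0 => //; exact: mulr_ge0.
  have B0 : 0 <= 8 * (x * y) by exact: mulr_ge0.
  rewrite (le_trans (ler_normD _ _)) // (ger0_norm A0) normrM (ger0_norm B0).
  have : X * Y * (x * y) <= 36 / 100 * (1 / 4) by exact: ler_pM.
  have : x * y * `|x * n + y * m| <= 1 / 4 * 1 by exact: ler_pM.
  by lra.
have tail (Z r k l : R) : 0 <= Z -> Z <= tau ^+ 3 / 4 -> 0 <= r <= 1 -> `|k| <= 1 ->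
    0 <= l <= 1 -> `|4 * tau * Z * (8 * r + k * w ^+ 2) * l| <= tau ^+ 2.
  move=> Z0 Z1 /andP[r0 r1] k1 /andP[l0 l1].
  have e0 : 0 <= 4 * tau * Z by rewrite !mulr_ge0 // ltW.
  rewrite 2!normrM (ger0_norm e0) (ger0_norm l0).
  have c : `|8 * r + k * w ^+ 2| <= 8 + w ^+ 2.
    rewrite (le_trans (ler_normD _ _)) // lerD //.
      by rewrite normrM ger0_norm // [`|r|]ger0_norm //; lra.
    by rewrite normrM [`|w ^+ 2|]ger0_norm ?sqr_ge0 // ler_piMl // sqr_ge0.
  have -> : tau ^+ 2 = tau ^+ 2 * 1 by rewrite mulr1.
  apply: ler_pM => //; first by rewrite mulr_ge0.
  apply: (@le_trans _ _ (4 * tau * (tau ^+ 3 / 4) * (8 + w ^+ 2))).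
    by apply: ler_pM => //; rewrite ler_pM2l // mulr_gt0.
  have -> : 4 * tau * (tau ^+ 3 / 4) * (8 + w ^+ 2) =
    tau ^+ 2 * (8 * tau ^+ 2 + (4 * tau * w) ^+ 2 / 16) by field.
  rewrite ler_piMr ?sqr_ge0 //.
  have : (4 * tau * w) ^+ 2 <= 1.
    by rewrite expr_le1 // !mulr_ge0 // ltW.
  by nra.
have T2 := tail (X * p) y n b; have T3 := tail (Y * q) x m a.
have {}T2 : `|4 * tau * (X * p) * (8 * y + n * w ^+ 2) * b| <= tau ^+ 2.
  by apply: T2 => //; [rewrite mulr_ge0 // ltW|lra|rewrite b0].
have {}T3 : `|4 * tau * (Y * q) * (8 * x + m * w ^+ 2) * a| <= tau ^+ 2.
  by apply: T3 => //; [rewrite mulr_ge0 // ltW|lra|rewrite a0].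
have T4 : `|p * q| <= tau ^+ 2 by rewrite ger0_norm // mulr_ge0.
rewrite (le_trans (ler_normD _ _)) //.
rewrite (le_trans (lerD (le_trans (ler_normD _ _) (lerD (ler_normD _ _) (lexx _))) (lexx _))) //.
move: T1 T2 T3 T4 (sqr_ge0 tau); set t2 := tau ^+ 2.
by move: (`|_|) (`|_|) (`|_|) (`|_|) => x1 x2 x3 x4; lra.
Qed.

End ModelJacobian.

Section ModelBracket.
Local Open Scope classical_set_scope.
Context {R : realType}.
Local Notation E := 'rV[R]_3.
Variable tau : R.
Hypotheses (tau0 : 0 < tau) (tau1 : tau <= 1 / 200).
Implicit Types (u : R) (x v : E) (i j : 'I_3).

Lemma is_derive_smooth_abs u : is_derive u (1 : R) (smooth_abs tau)
  (- (1 / 2 + 2 * tau - u) / smooth_abs tau u).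
Proof.
pose p (t : R) := (1 / 2 + 2 * tau - t) ^+ 2 + (tau ^+ 3) ^+ 2.
have dp : is_derive u (1 : R) p (- (2 * (1 / 2 + 2 * tau - u))).
  have dl := is_deriveB (is_derive_cst (1 / 2 + 2 * tau) u (1 : R)) (is_derive_id u (1 : R)).
  have dq := is_deriveD (is_deriveM dl dl) (is_derive_cst ((tau ^+ 3) ^+ 2) u (1 : R)).
  rewrite (_ : p = (cst (1 / 2 + 2 * tau) - id) * (cst (1 / 2 + 2 * tau) - id)
     + cst ((tau ^+ 3) ^+ 2)); last by apply/funext => t; rewrite /p expr2.
  apply: is_derive_eq dq _; rewrite -[(_ - id) u]/(1 / 2 + 2 * tau - u).
  by rewrite /GRing.scale /=; ring.
have ds : is_derive (p u) (1 : R) Num.sqrt (2 * smooth_abs tau u)^-1.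
  exact: is_derive1_sqrt (smooth_abs_arg_gt0 tau0 u).
have dc : is_derive u (1 : R) (smooth_abs tau) _ := is_derive1_comp ds dp.
apply: is_derive_eq; field.
by rewrite gt_eqF // smooth_abs_gt0.
Qed.

Lemma is_derive_ramp_down u : is_derive u (1 : R) (ramp_down tau)
  (- (ramp_down tau u / smooth_abs tau u)).
Proof.
have dh := is_derive_smooth_abs u.
have dl := is_deriveB (is_derive_cst (1 / 2 + 2 * tau) u (1 : R)) (is_derive_id u (1 : R)).
have dr := is_deriveZ (1 / 2 : R) (is_deriveD dh dl).
rewrite [X in is_derive _ _ X _](_ : ramp_down tau =
    (1 / 2 : R) *: (smooth_abs tau + (cst (1 / 2 + 2 * tau) - id))).
  apply: is_derive_eq dr _; rewrite /GRing.scale /= /ramp_down; field.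
  by rewrite gt_eqF // smooth_abs_gt0.
by apply/funext => t; rewrite /ramp_down mulrC div1r.
Qed.

Lemma is_derive_ramp_up u : is_derive u (1 : R) (ramp_up tau)
  (ramp_up tau u / smooth_abs tau u).
Proof.
have dh := is_derive_smooth_abs u.
have dl := is_deriveB (is_derive_cst (1 / 2 + 2 * tau) u (1 : R)) (is_derive_id u (1 : R)).
have dr := is_deriveZ (1 / 2 : R) (is_deriveB dh dl).
rewrite [X in is_derive _ _ X _](_ : ramp_up tau =
    (1 / 2 : R) *: (smooth_abs tau - (cst (1 / 2 + 2 * tau) - id))).
  apply: is_derive_eq dr _; rewrite /GRing.scale /= /ramp_up; field.
  by rewrite gt_eqF // smooth_abs_gt0.
by apply/funext => t; rewrite /ramp_up mulrC div1r.
Qed.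


Lemma Cinf_coord i : Cinf_on setT (fun x : E => x 0 i).
Proof.
case=> [|k]; first by move=> x _; exact: coord_continuous.
split=> [x _|v]; first exact: differentiable_coord.
rewrite (_ : 'D_v _ = cst (v 0 i)); first exact: Ck_cst.
by apply/funext => x; rewrite derive_coord.
Qed.

Lemma Cinf_smooth_abs i : Cinf_on setT (fun x : E => smooth_abs tau (x 0 i ^+ 2)).
Proof.
apply: Cinf_sqrt => [x|]; first exact: smooth_abs_arg_gt0.
pose p (x : E) := 1 / 2 + 2 * tau - x 0 i ^+ 2.
have cp : Cinf_on setT p.
  rewrite (_ : p = cst (1 / 2 + 2 * tau) \+ (cst (-1) \*
    ((fun x : E => x 0 i) \* (fun x : E => x 0 i)))).
    apply: CinfD; first exact: Cinf_cst.
    apply: CinfM; first exact: Cinf_cst.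
    by apply: CinfM; exact: Cinf_coord.
  by apply/funext => x; rewrite /p /= mulN1r expr2.
rewrite (_ : (fun x : E => _) = (p \* p) \+ cst ((tau ^+ 3) ^+ 2)).
  by apply: CinfD; [exact: CinfM|exact: Cinf_cst].
by apply/funext => x; rewrite /= -expr2.
Qed.

Lemma Cinf_affine_smooth_abs i (a b c : R) :
  Cinf_on setT (fun x : E => a * smooth_abs tau (x 0 i ^+ 2) + b + c * x 0 i ^+ 2).
Proof.
rewrite (_ : (fun x => _) = (cst a \* (fun x : E => smooth_abs tau (x 0 i ^+ 2)) \+ cst b)
  \+ (cst c \* ((fun x : E => x 0 i) \* (fun x : E => x 0 i)))) //.
by do ![apply: CinfD | apply: CinfM | exact: Cinf_cst | exact: Cinf_coord
  | exact: Cinf_smooth_abs].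
Qed.

Definition model_ext i j (x : E) : R := model tau (x 0 i ^+ 2) (x 0 j ^+ 2).

Lemma Cinf_model i j : Cinf_on setT (model_ext i j).
Proof.
pose D i (x : E) := ramp_down tau (x 0 i ^+ 2).
pose Q (x : E) := ramp_up tau (x 0 i ^+ 2).
have cD k : Cinf_on setT (D k).
  rewrite (_ : D k = (fun x : E => 1 / 2 * smooth_abs tau (x 0 k ^+ 2)
    + (1 / 2 + 2 * tau) / 2 + - (1 / 2) * x 0 k ^+ 2)); first exact: Cinf_affine_smooth_abs.
  by apply/funext => x; rewrite /D /ramp_down; field.
have cQ : Cinf_on setT Q.
  rewrite (_ : Q = (fun x : E => 1 / 2 * smooth_abs tau (x 0 i ^+ 2)
    + - (1 / 2 + 2 * tau) / 2 + 1 / 2 * x 0 i ^+ 2)); first exact: Cinf_affine_smooth_abs.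
  by apply/funext => x; rewrite /Q /ramp_up; field.
rewrite (_ : model_ext i j = (cst (1 / 4 - tau / 4) \+ (cst (4 * tau) \*
  ((D j \* (cst 1 \+ (cst (-4) \* (D i \* D i)))) \* (fun x => ((D i \+ D j) x)^-1)))) \+ Q).
  have W0 x : (D i \+ D j) x != 0.
    by rewrite gt_eqF //= addr_gt0 // ramp_down_gt0.
  apply: CinfD => //; apply: CinfD; first exact: Cinf_cst.
  apply: CinfM; first exact: Cinf_cst.
  apply: CinfM; last by apply: CinfV => //; exact: CinfD.
  apply: CinfM => //; apply: CinfD; first exact: Cinf_cst.
  apply: CinfM; [exact: Cinf_cst|exact: CinfM].
by apply/funext => x; rewrite /model_ext /model /= -/(D i x) -/(D j x) mulNr -expr2.
Qed.

Lemma derive_comp_sqr i (g : R -> R) x v (c : R) :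
  is_derive (x 0 i ^+ 2) (1 : R) g c ->
  is_derive x v (fun y : E => g (y 0 i ^+ 2)) (c * (2 * x 0 i * v 0 i)).
Proof.
move=> dg; pose f (y : E) := y 0 i.
have df : differentiable f x by exact: differentiable_coord.
have dff : differentiable (f * f) x by exact: differentiableM.
have gE : is_derive ((f * f) x) (1 : R) g c by rewrite -[(f * f) x]/(f x * f x) -expr2.
have [dgf D] := derive_comp1 v dff gE.
rewrite (_ : (fun y : E => _) = g \o (f * f)); last by apply/funext => y /=; rewrite expr2.
apply: DeriveDef; first exact: diff_derivable.
rewrite D deriveM; [|exact: diff_derivable|exact: diff_derivable].
by rewrite derive_coord /GRing.scale /= -/(f x); ring.
Qed.

Lemma derive_model i j x v : 'D_v (model_ext i j) x =
  model_u tau (x 0 i ^+ 2) (x 0 j ^+ 2) * (2 * x 0 i * v 0 i)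
  + model_v tau (x 0 i ^+ 2) (x 0 j ^+ 2) * (2 * x 0 j * v 0 j).
Proof.
pose D k (y : E) := ramp_down tau (y 0 k ^+ 2).
pose Q (y : E) := ramp_up tau (y 0 i ^+ 2).
have dX := derive_comp_sqr v (is_derive_ramp_down (x 0 i ^+ 2)).
have dY := derive_comp_sqr v (is_derive_ramp_down (x 0 j ^+ 2)).
have dQ := derive_comp_sqr v (is_derive_ramp_up (x 0 i ^+ 2)).
have W0 : D i x + D j x != 0 by rewrite gt_eqF // addr_gt0 // ramp_down_gt0.
rewrite -/(D i) in dX; rewrite -/(D j) in dY; rewrite -/Q in dQ.
set dx := - _ * _ in dX; set dy := - _ * _ in dY; set dq := _ * _ in dQ.
have dW : is_derive x v (fun y => (D i y + D j y)^-1)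
    (- ((D i x + D j x) ^+ 2)^-1 * (dx + dy)).
  have dS : is_derive x v (D i + D j) (dx + dy) by exact: is_deriveD.
  have eS : derivable (D i + D j) x v := @ex_derive _ _ _ _ _ _ _ dS.
  apply: DeriveDef; first by apply: (@derivableV _ _ (D i + D j)).
  rewrite (@deriveV _ _ (D i + D j)) // (@derive_val _ _ _ _ _ _ _ dS).
  by rewrite /GRing.scale.
have dm := is_deriveB (is_derive_cst (1 : R) x v) (is_deriveZ (4 : R) (is_deriveM dX dX)).
have dM := is_deriveD (is_deriveD (is_derive_cst (1 / 4 - tau / 4) x v)
  (is_deriveZ (4 * tau) (is_deriveM (is_deriveM dY dm) dW))) dQ.
rewrite (_ : model_ext i j = cst (1 / 4 - tau / 4) + (4 * tau) *:
   ((D j * (cst 1 - (4 : R) *: (D i * D i))) * (fun y => (D i y + D j y)^-1)) + Q).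
  apply: (etrans (@derive_val _ _ _ _ _ _ _ dM)).
  rewrite /dx /dy /dq /model_u /model_v -/(D i x) -/(D j x) -/(Q x) /GRing.scale /=.
  rewrite -[(D j * _) x]/(D j x * (1 - 4 * (D i x * D i x))).
  rewrite -[(cst 1 - _) x]/(1 - 4 * (D i x * D i x)).
  by field; rewrite W0 !gt_eqF ?smooth_abs_gt0.
by apply/funext => y; rewrite /model_ext /model expr2.
Qed.

End ModelBracket.

Section Profile.
Local Open Scope classical_set_scope.
Context {R : realType}.
Local Notation E := 'rV[R]_3.
Implicit Types (tau : R) (p : S2 R) (i j : 'I_3).

Definition model_S2 tau i j p : R := model_ext tau i j (p : E).

Lemma model_S2_extension tau i j p : 0 < tau ->
  smooth_extension (model_S2 tau i j) p (model_ext tau i j).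
Proof. by move=> tau0; exists setT; split=> //; [exact: openT|exact: Cinf_model]. Qed.

Lemma S2_coords p : (p : E) 0 0 ^+ 2 + (p : E) 0 1 ^+ 2 + (p : E) 0 2%:R ^+ 2 = 1.
Proof. by rewrite !expr2 -dot3E S2valP. Qed.

Lemma model_poisson tau p : 0 < tau -> tau <= 1 / 200 ->
  `|poisson (model_S2 tau 0 1) (model_S2 tau 1 0) p| <= 600 * tau ^+ 2.
Proof.
move=> tau0 tau1.
rewrite (poissonE (model_S2_extension 0 1 p tau0) (model_S2_extension 1 0 p tau0)).
rewrite /ambient_bracket /partial !(derive_model tau0) !mxE /=.
have := S2_coords p; have := @model_jacobian R tau tau0 tau1 ((p : E) 0 0 ^+ 2) ((p : E) 0 1 ^+ 2).
set x := (p : E) 0 0; set y := (p : E) 0 1; set z := (p : E) 0 2%:R.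
rewrite !sqr_ge0 => /(_ isT isT) J xyz.
have {}J := J ltac:(by rewrite -xyz lerDl sqr_ge0).
set A := model_u _ _ _ in J *; set B := model_u _ _ _ in J *.
set C := model_v _ _ _ in J *; set D := model_v _ _ _ in J *.
rewrite normrN.
rewrite (_ : _ + _ = 4 * (x * y * z) * (A * B - C * D)); last by ring.
have xyz1 : `|x * y * z| <= 1.
  rewrite -(@ler_sqr _ `|_|) ?nnegrE // expr1n real_normK ?num_real // !exprMn.
  have := sqr_ge0 x; have := sqr_ge0 y; have := sqr_ge0 z.
  move: (x ^+ 2) (y ^+ 2) (z ^+ 2) xyz => a b c abc c0 b0 a0.
  have [a1 b1 c1] : [/\ a <= 1, b <= 1 & c <= 1] by split; lra.
  by rewrite mulr_ile1 ?mulr_ge0 ?mulr_ile1.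
rewrite normrM (_ : 600 * tau ^+ 2 = 4 * (150 * tau ^+ 2)); last by ring.
apply: ler_pM => //; rewrite normrM ger0_norm //.
by rewrite ler_piMr.
Qed.

Lemma smooth_cst (c : R) : smooth (fun=> c : R).
Proof.
by move=> p; exists (cst c), setT; split=> //; [exact: openT|exact: Cinf_cst].
Qed.

Lemma poisson_cst (c d : R) p : poisson (fun=> c) (fun=> d) p = 0.
Proof.
have ext (e : R) : smooth_extension (fun=> e) p (cst e).
  by exists setT; split=> //; [exact: openT|exact: Cinf_cst].
rewrite (poissonE (ext c) (ext d)) /ambient_bracket /partial !derive_cst.
by rewrite !mul0r !subrr !mulr0 !addr0 oppr0.
Qed.

Lemma smooth_sqr_coord i : smooth (fun p => (p : E) 0 i ^+ 2).
Proof.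
move=> p; pose f (x : E) := x 0 i.
exists (f \* f), setT; split=> [||| q _]; [exact: openT|by []| |by rewrite expr2].
by apply: CinfM; exact: Cinf_coord.
Qed.

End Profile.

Theorem theorem1p5 (R : realType) (smax : R) (hsmax : 0 < smax) :
  let F : S2 R -> R := fun p => (S2val p) 0 0 ^+ 2 in
  let G : S2 R -> R := fun p => (S2val p) 0 1 ^+ 2 in
  exists C : R, 0 < C /\
    forall s : R, 0 <= s <= smax ->
      profile F G s <= profile F G 0 - C * Num.sqrt s.
Proof.
move=> F G.
have sF : smooth F := smooth_sqr_coord 0.
have sG : smooth G := smooth_sqr_coord 1.
have lower : 1 / 2 <= profile F G 0.
  apply: lb_le_inf.
    exists (udist (F, G) (fun=> 0, fun=> 0)); exists (fun=> 0, fun=> 0) => //.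
    split; [exact: smooth_cst|exact: smooth_cst|].
    by apply: unorm_le => // q; rewrite poisson_cst normr0.
  move=> _ [[H K] [/= sH sK HK0] <-]; rewrite /udist /=.
  apply: (commuting_dist_lower_bound sH sK (poisson_eq0 sH sK HK0)) => p.
    by apply: (@norm_le_unorm R (F \- H)); exact: smooth_bounded.
  by apply: (@norm_le_unorm R (G \- K)); exact: smooth_bounded.
pose m := Num.sqrt smax.
have m0 : 0 < m by rewrite sqrtr_gt0.
pose c := Num.min (1 / 200 / m) (1 / 30).
have c0 : 0 < c by rewrite lt_min !divr_gt0.
exists (c / 4); split; first by rewrite divr_gt0.
move=> s /andP[]; rewrite le_eqVlt => /predU1P[<- _|s0 ss].
  by rewrite sqrtr0 mulr0 subr0.
have r0 : 0 < Num.sqrt s by rewrite sqrtr_gt0.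
have r2 : Num.sqrt s ^+ 2 = s by rewrite sqr_sqrtr // ltW.
have rm : Num.sqrt s <= m by rewrite ler_sqrt // ltW.
move: (Num.sqrt s) r0 r2 rm => r r0 r2 rm.
pose tau := c * r.
have tau0 : 0 < tau by exact: mulr_gt0.
have tau1 : tau <= 1 / 200.
  apply: (@le_trans _ _ (1 / 200 / m * m)); last by rewrite divfK // gt_eqF.
  by apply: ler_pM; rewrite ?(ltW c0) ?(ltW r0) // ge_min lexx.
have taus : 600 * tau ^+ 2 <= s.
  have c30 : c <= 1 / 30 by rewrite ge_min lexx orbT.
  have cc : c * c <= 1 / 30 * (1 / 30) by apply: ler_pM => //; exact: ltW.
  have c600 : 600 * (c * c) <= 1 by lra.
  rewrite /tau exprMn r2 mulrA expr2.
  exact: ler_piMl (ltW s0) c600.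
apply: (@le_trans _ _ (1 / 2 - tau / 4)); last by rewrite /tau; lra.
pose H := model_S2 tau 0 1; pose K := model_S2 tau 1 0.
apply: (@le_trans _ _ (udist (F, G) (H, K))).
  apply: ge_inf.
    exists 0 => _ [[H' K'] _ <-]; rewrite /udist.
    by rewrite addr_ge0 ?unorm_ge0.
  exists (H, K) => //; split=> /=.
  - by move=> p; exists (model_ext tau 0 1); exact: model_S2_extension.
  - by move=> p; exists (model_ext tau 1 0); exact: model_S2_extension.
  - apply: le_trans taus; apply: unorm_le => [|q]; last exact: model_poisson.
    by rewrite mulr_ge0 ?ler0n ?sqr_ge0.
have b0 : 0 <= 1 / 4 - tau / 8 by lra.
rewrite (_ : 1 / 2 - tau / 4 = (1 / 4 - tau / 8) + (1 / 4 - tau / 8)); last by field.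
apply: lerD; apply: unorm_le => //= p; have xyz := S2_coords p;
  have z0 := sqr_ge0 ((S2val p) 0 2%:R);
  by apply: model_dist => //; rewrite /F /G ?sqr_ge0 //; lra.
Qed.
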